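(* There is an absolute constant $C>0$ such that the following holds. Let $\varepsilon\in(0,1)$, $\eta\in(0,\tfrac12)$, let $b'\ge1$ be an integer and \[ b\ \ge\ \frac{(1+\eta)^2}{1-\eta}\,b'+C\,\frac{\log^2 n}{\eta^4\varepsilon}. \] There is an $\varepsilon$-LEDP algorithm that terminates in $O(\log n)$ rounds and, on any $n$-vertex input graph $G$, with high probability outputs an implicit $b$-matching in the billboard model whose size is at least $\frac12\mathrm{OPT}_{b'}(G)$, where $\mathrm{OPT}_{b'}(G)$ is the size of a maximum $b'$-matching.
   Context: A $b$-matching is a set of edges in which every vertex has degree at most $b$. LEDP: each node knows only its adjacency list; in rounds, nodes apply local randomizers (edge-DP functions of their adjacency list, possibly depending on the public transcript) whose outputs are appended to a public transcript; the number of rounds is the length of the transcript; the protocol is $\varepsilon$-LEDP if the map from the graph to the full transcript is $\varepsilon$-edge DP (edge-neighboring graphs differ in one edge). Billboard model: each node $v$ deterministically decodes its part of the solution from the public transcript and $N(v)$. An implicit solution $\mathcal S=\{S_v\}$ defines $H(\mathcal S)$ with edges $\{u,v\}$ such that $u\in S_v$ or $v\in S_u$; an implicit $b$-matching has $G\cap H(\mathcal S)$ of maximum degree at most $b$, and its size is $|E(G)\cap E(H(\mathcal S))|$. ''With high probability'' means probability at least $1-n^{-c}$ for a constant $c\ge1$. *)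

(* Defs.v *)
From HB Require Import structures.
From mathcomp Require Import all_boot all_order all_algebra.
From mathcomp Require Import all_classical all_reals all_analysis.

Set Implicit Arguments.
Unset Strict Implicit.
Unset Printing Implicit Defensive.

Import Order.TTheory GRing.Theory Num.Theory.
Local Open Scope ring_scope.

Section Graphs.
Variable n : nat.

(* A simple graph on the vertex set 'I_n, given by its set of edges. *)
Record graph := Graph {
  edges : {set {set 'I_n}};
  edges_card2 : forall e, e \in edges -> #|e| = 2%N
}.

Definition nbhd (G : graph) (v : 'I_n) : {set 'I_n} :=
  [set u | [set u; v]%SET \in edges G].

(* Two finite sets that differ in exactly one element. *)
Definition differ_by_one (T : finType) (A B : {set T}) : Prop :=
  #|(A :\: B) :|: (B :\: A)| = 1%N.

Definition edge_neighbors (G G' : graph) : Prop :=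
  differ_by_one (edges G) (edges G').

Definition degree_in (F : {set {set 'I_n}}) (v : 'I_n) : nat :=
  #|[set e in F | v \in e]|.

Definition is_bmatching (b : nat) (G : graph) (M : {set {set 'I_n}}) : bool :=
  (M \subset edges G) && [forall v, (degree_in M v <= b)%N].

Definition OPT (b : nat) (G : graph) : nat :=
  (\max_(M : {set {set 'I_n}} | is_bmatching b G M) #|M|)%N.

Definition implicit_edges (S : 'I_n -> {set 'I_n}) : {set {set 'I_n}} :=
  [set e : {set 'I_n} | [exists u, exists v,
     [&& e == [set u; v]%SET, u != v & (u \in S v) || (v \in S u)]]].

Definition implicit_bmatching (b : nat) (G : graph) (S : 'I_n -> {set 'I_n})
  : bool :=
  [forall v, (degree_in (edges G :&: implicit_edges S) v <= b)%N].

Definition implicit_size (G : graph) (S : 'I_n -> {set 'I_n}) : nat :=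
  #|edges G :&: implicit_edges S|.

End Graphs.

Section LEDP.
Variables (R : realType) (n : nat).

(* Messages range over a countable alphabet, coded by nat (with its discrete
   sigma-algebra); adjacency lists are represented as sets of vertices. *)
Record local_randomizer := LocalRandomizer {
  randomize :> {set 'I_n} -> probability nat R;
  randomize_dp : exists2 eps0 : R, 0 <= eps0 &
    forall (A A' : {set 'I_n}) (Y : set nat), differ_by_one A A' ->
      (randomize A Y <= (expR eps0)%:E * randomize A' Y)%E
}.

(* The public transcript lists, round by round, the message of every node.
   A silent node is one whose message is constant. *)
Definition transcript := seq {ffun 'I_n -> nat}.

(* From the transcript so far, a protocol either halts ([None]) or assigns to
   every node the local randomizer to be applied in the next round. *)
Definition protocol := transcript -> option ('I_n -> local_randomizer).

(* [run_prob P G past rest]: probability, given that the transcript so far is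
   [past], that exactly the rounds [rest] follow and that the protocol then
   halts; nodes randomize independently in each round. *)
Fixpoint run_prob (P : protocol) (G : graph n) (past rest : transcript) : R :=
  match P past, rest with
  | None, [::] => 1
  | Some r, o :: rest' =>
      (\prod_(v < n) fine (r v (nbhd G v) [set o v]%classic)) *
      run_prob P G (rcons past o) rest'
  | _, _ => 0
  end.

(* Probability that the complete transcript of [P] run on [G] lies in [E]. *)
Definition transcript_prob (P : protocol) (G : graph n) (E : set transcript)
  : \bar R :=
  (\esum_(tau in E) (run_prob P G [::] tau)%:E)%E.

Definition is_LEDP (eps : R) (P : protocol) : Prop :=
  forall (G G' : graph n) (E : set transcript), edge_neighbors G G' ->
    (transcript_prob P G E <= (expR eps)%:E * transcript_prob P G' E)%E.

(* Every transcript all of whose rounds are actually executed, whatever the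
   messages, has at most T rounds; in particular the protocol always halts. *)
Definition terminates_within (T : R) (P : protocol) : Prop :=
  forall tau : transcript,
    (forall t, (t < size tau)%N -> isSome (P (take t tau))) ->
    (size tau)%:R <= T.

(* Billboard model: each node decodes its part of the solution from the public
   transcript and its own neighborhood. *)
Definition decoder := 'I_n -> transcript -> {set 'I_n} -> {set 'I_n}.

Definition decoded (D : decoder) (G : graph n) (tau : transcript)
  : 'I_n -> {set 'I_n} :=
  fun v => D v tau (nbhd G v).

End LEDP.

(* Main.v *)
Require Import Defs.
From HB Require Import structures.
From mathcomp Require Import all_boot all_order all_algebra.
From mathcomp Require Import all_classical all_reals all_analysis.
From mathcomp Require Import ring lra zify.

Import Order.TTheory GRing.Theory Num.Theory.
Local Open Scope ring_scope.

Set Implicit Arguments.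
Unset Strict Implicit.
Unset Printing Implicit Defensive.

(** A fractional [b]-matching of value at least [0.52] times the optimum (for the
    capacity [b], hence also for [b' <= b]) is computed by two phases of
    multiplicative growth: every edge value starts at [1/n] and
    grows by a factor [101/100] per round until one endpoint freezes, which it
    announces by a bit whose probability is logistic in (load - threshold).
    Such a bit is differentially private because an edge changes a load by at
    most 1, and with [eps / O(log n)] per bit it is wrong only within
    [O(log^2 n / eps)] of the threshold.

    Phase 1 has threshold about [0.58 b]; let [H] be the frozen nodes. Phase 2
    grows only the edges between [H] and its complement, with threshold about
    [0.97 b]. A single phase with threshold [b] would give the ratio 1/2 minus a
    constant. With two, give price 1/2 to every node of [H] and a further 1/2
    to every node frozen in phase 2: each edge of value less than 1 is covered,
    so the prices are dual feasible, and charging phase 2 values unevenly to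
    the two sides shows that the dual is at most [2/1.04] times the primal.

    In a last round, public coins round the fractional solution; Chernoff bounds
    lose less than the 4% to spare. *)

(** * Product Bernoulli measures on a finite alphabet *)
Section FiniteSupport.
Variables (R : realType) (T : finType).

Lemma prob_of_pmf (pm : T -> R) (code : T -> nat) :
  (forall a, 0 <= pm a) -> \sum_a pm a = 1 ->
  exists mu : probability nat R, forall Y : set nat,
    mu Y = (\sum_a pm a * \1_Y (code a))%:E.
Proof.
move=> pm0 pm1.
(* [msum] sums a sequence of measures: weighted Dirac masses along the enumeration of [T], and the
   zero measure at indices outside it. *)
pose m (k : nat) : {measure set nat -> \bar R} :=
  if insub k is Some i then
    mscale (NngNum (pm0 (@enum_val T predT i))) (dirac (code (@enum_val T predT i)))
  else mzero.
pose nu := msum m #|T|.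
have nuE Y : nu Y = (\sum_a pm a * \1_Y (code a))%:E.
  rewrite /nu /msum -sumEFin (reindex_onto (@enum_val T predT) enum_rank) /=;
    last by move=> i _; rewrite enum_rankK.
  apply: eq_big => [i|i _]; first by rewrite enum_valK eqxx.
  rewrite /m; case: insubP => [j _ ij|]; last by rewrite ltn_ord.
  rewrite (ord_inj ij).
  transitivity ((pm (enum_val i))%:E * \d_(code (enum_val i)) Y)%E; first by [].
  by rewrite diracE EFinM indicE.
have nuT : nu setT = 1%E.
  rewrite nuE; congr (_%:E); rewrite -pm1; apply: eq_bigr => a _.
  by rewrite indicT mulr1.
pose mk := Measure_isProbability.Build _ _ _ nu nuT.
exists (HB.pack nu mk : probability nat R).
exact: nuE.
Qed.

Lemma fine_sum_set1 (pm : T -> R) (code : T -> nat) (mu : probability nat R) a :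
  injective code ->
  (forall Y : set nat, mu Y = (\sum_a pm a * \1_Y (code a))%:E) ->
  fine (mu [set code a]%classic) = pm a.
Proof.
move=> inj ->; rewrite /= (bigD1 a) //= indicE mem_set // mulr1 big1 ?addr0 // => i ia.
rewrite indicE memNset ?mulr0 //= => /inj E; by rewrite E eqxx in ia.
Qed.

(** Accuracy needs only a lower bound on the probability of a set of transcripts, so finitely many
    explicit transcripts suffice. *)
Lemma esum_ge_seq (I : choiceType) (E : set I) (f : I -> R) (s : seq I) :
  uniq s -> (forall i, 0 <= f i) ->
  ((\sum_(i <- s) f i * \1_E i)%:E <= \esum_(i in E) (f i)%:E)%E.
Proof.
move=> us f0; apply: esum_ge.
exists [set` [seq i <- s | i \in E]]%classic.
  by split=> // i /=; rewrite mem_filter => /andP[/set_mem].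
rewrite -fsbig_seq ?filter_uniq // big_filter -sumEFin big_mkcond [leRHS]big_mkcond /=.
by apply: lee_sum => i _; rewrite indicE; case: (_ \in _); rewrite ?mulr1 ?mulr0.
Qed.

End FiniteSupport.

Section ProductBernoulli.
Variables (R : realType) (T : finType).

Definition bern (p : R) (b : bool) : R := if b then p else 1 - p.

Definition subset_pmf (p : T -> R) (A : {set T}) : R := \prod_u bern (p u) (u \in A).

Lemma bern_ge0 p b : 0 <= p <= 1 -> 0 <= bern p b.
Proof. by case: b => /andP[]; rewrite /bern ?subr_ge0. Qed.

Lemma subset_pmf_ge0 (p : T -> R) A : (forall u, 0 <= p u <= 1) -> 0 <= subset_pmf p A.
Proof. by move=> h; apply: prodr_ge0 => u _; apply: bern_ge0. Qed.

Lemma sum_subset_prod (g : T -> bool -> R) :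
  \sum_(A : {set T}) \prod_u g u (u \in A) = \prod_u (g u true + g u false).
Proof.
rewrite bigA_distr; apply: eq_bigr => A _; apply: eq_bigr => u _.
by case: (u \in A).
Qed.

Lemma sum_subset_pmf (p : T -> R) : \sum_A subset_pmf p A = 1.
Proof.
rewrite (sum_subset_prod (fun u => bern (p u))) big1 // => u _.
by rewrite /bern addrC subrK.
Qed.

End ProductBernoulli.

(** * Independent coins indexed by ordered pairs, and Chernoff bounds *)

Section JointBernoulli.
Variables (R : realType) (T : finType).
Implicit Types (th : T -> T -> R) (o : {ffun T -> {set T}}).

Definition joint th o : R := \prod_v subset_pmf (th v) (o v).

Lemma joint_ge0 th o : (forall v u, 0 <= th v u <= 1) -> 0 <= joint th o.
Proof. by move=> h; apply: prodr_ge0 => v _; apply: subset_pmf_ge0. Qed.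

(** Independence of the coins: the expectation of a product of functions of single coins factors.
    Marginals and moment generating functions are instances. *)
Lemma joint_expect th (g : T -> T -> bool -> R) :
  \sum_o joint th o * \prod_v \prod_u g v u (u \in o v) =
  \prod_v \prod_u (th v u * g v u true + (1 - th v u) * g v u false).
Proof.
transitivity (\sum_(o : {ffun T -> {set T}})
    \prod_v (subset_pmf (th v) (o v) * \prod_u g v u (u \in o v))).
  by apply: eq_bigr => o _; rewrite [RHS]big_split.
rewrite -(bigA_distr_bigA (fun v A => subset_pmf (th v) A * \prod_u g v u (u \in A))).
apply: eq_bigr => v _.
transitivity (\sum_(A : {set T}) \prod_u (bern (th v u) (u \in A) * g v u (u \in A))).
  by apply: eq_bigr => A _; rewrite [RHS]big_split.
exact: (sum_subset_prod (fun u b => bern (th v u) b * g v u b)).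
Qed.

Lemma sum_joint th : \sum_o joint th o = 1.
Proof.
rewrite -(bigA_distr_bigA (fun v A => subset_pmf (th v) A)) big1 // => v _.
exact: sum_subset_pmf.
Qed.

Lemma joint_coordinate th v0 u0 (b : bool) :
  \sum_o joint th o * ((u0 \in o v0) == b)%:R = bern (th v0 u0) b.
Proof.
pose g v u (c : bool) : R := if (v == v0) && (u == u0) then (c == b)%:R else 1.
transitivity (\sum_o joint th o * \prod_v \prod_u g v u (u \in o v)).
  apply: eq_bigr => o _; congr (_ * _).
  rewrite (bigD1 v0) //= (bigD1 u0) //= {1}/g !eqxx /=.
  rewrite big1 ?mulr1 => [|u uu0]; last by rewrite /g (negbTE uu0) andbF.
  rewrite big1 ?mulr1 // => v vv0; rewrite big1 // => u _.
  by rewrite /g (negbTE vv0).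
rewrite joint_expect (bigD1 v0) //= (bigD1 u0) //= {1 2}/g !eqxx /=.
rewrite big1 ?mulr1 => [|u uu0]; last by rewrite /g (negbTE uu0) andbF !mulr1 addrC subrK.
rewrite big1 ?mulr1 => [|v vv0].
  by case: b {g}; rewrite /= ?mulr1 ?mulr0 ?addr0 ?add0r.
by rewrite big1 // => u _; rewrite /g (negbTE vv0) /= !mulr1 addrC subrK.
Qed.

Definition hits (J : {set T * T}) o : nat := #|[set vu in J | vu.2 \in o vu.1]|.

(** Each coin of bias [p] contributes [1 + (r - 1) * p], which is at most [expR ((r - 1) * p)]. The
    tails below take [r = 1 + s] and [r = 1 - s], so that no logarithm appears. *)
Lemma joint_mgf th (J : {set T * T}) (r : R) :
  (forall v u, 0 <= th v u <= 1) -> 0 <= r ->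
  \sum_o joint th o * r ^+ hits J o <= expR ((r - 1) * \sum_(vu in J) th vu.1 vu.2).
Proof.
move=> th01 r0.
pose g v u (c : bool) : R := if ((v, u) \in J) && c then r else 1.
have -> : \sum_o joint th o * r ^+ hits J o =
    \sum_o joint th o * \prod_v \prod_u g v u (u \in o v).
  apply: eq_bigr => o _; congr (_ * _).
  rewrite pair_big /= /hits -prodr_const big_mkcond /=.
  by apply: eq_bigr => -[v u] _; rewrite inE /g.
rewrite joint_expect pair_big /= mulr_sumr expR_sum [leRHS]big_mkcond /=.
apply: ler_prod => -[v u] _ /=; rewrite /g andbT andbF.
have /andP[a0 a1] := th01 v u.
have a1' : 0 <= 1 - th v u by rewrite subr_ge0.
case: ifP => _; last by rewrite !mulr1 addrC subrK ler01 lexx.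
rewrite mulr1 addr_ge0 ?mulr_ge0 //=.
by apply: le_trans (expR_ge1Dx _); lra.
Qed.

Lemma hits_upper_tail th (J : {set T * T}) (s : R) (k : nat) :
  (forall v u, 0 <= th v u <= 1) -> 0 < s ->
  \sum_o joint th o * (k < hits J o)%N%:R <=
  expR (s * (\sum_(vu in J) th vu.1 vu.2 - k%:R / (1 + s))).
Proof.
move=> th01 s0; set m := \sum_(vu in J) th vu.1 vu.2.
have s1 : 0 < 1 + s by rewrite addr_gt0.
(* Markov's inequality costs the factor [(1 + s)^-1 ^+ k]; this turns it into an exponential. *)
have base : (1 + s)^-1 <= expR (- (s / (1 + s))).
  apply: le_trans (expR_ge1Dx _).
  by have -> : 1 - s / (1 + s) = (1 + s)^-1 by field; exact: lt0r_neq0.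
have := joint_mgf J th01 (ltW s1); have -> : 1 + s - 1 = s by ring.
rewrite -/m => mgf.
have -> : s * (m - k%:R / (1 + s)) = s * m + k%:R * - (s / (1 + s)) by lra.
rewrite expRD mulrC expRM_natl.
apply: le_trans (ler_pM _ _ (lerXn2r k _ _ base) mgf); rewrite ?nnegrE ?exprn_ge0 ?expR_ge0 ?invr_ge0 ?(ltW s1) //.
  rewrite mulr_sumr; apply: ler_sum => o _.
  rewrite mulrCA ler_wpM2l ?joint_ge0 // exprVn mulrC.
  case: ltnP => h /=; last by rewrite divr_ge0 ?exprn_ge0 ?ltW.
  by rewrite ler_pdivlMr ?exprn_gt0 // mul1r ler_weXn2l // ?lerDl (ltW s0, ltnW h).
by apply: sumr_ge0 => o _; rewrite mulr_ge0 ?joint_ge0 ?exprn_ge0 // ltW.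
Qed.

Lemma hits_lower_tail th (J : {set T * T}) (s : R) (k : nat) :
  (forall v u, 0 <= th v u <= 1) -> 0 < s -> s < 1 ->
  \sum_o joint th o * (hits J o <= k)%N%:R <=
  expR (s * (k%:R / (1 - s) - \sum_(vu in J) th vu.1 vu.2)).
Proof.
move=> th01 s0 s1; set m := \sum_(vu in J) th vu.1 vu.2.
have s1' : 0 < 1 - s by rewrite subr_gt0.
have base : (1 - s)^-1 <= expR (s / (1 - s)).
  apply: le_trans (expR_ge1Dx _).
  by have -> : 1 + s / (1 - s) = (1 - s)^-1 by field; exact: lt0r_neq0.
have := joint_mgf J th01 (ltW s1'); rewrite -/m => mgf.
have -> : s * (k%:R / (1 - s) - m) = (1 - s - 1) * m + k%:R * (s / (1 - s)) by lra.
rewrite expRD mulrC expRM_natl.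
apply: le_trans (ler_pM _ _ (lerXn2r k _ _ base) mgf); rewrite ?nnegrE ?exprn_ge0 ?expR_ge0 ?invr_ge0 ?(ltW s1') //.
  rewrite mulr_sumr; apply: ler_sum => o _.
  rewrite mulrCA ler_wpM2l ?joint_ge0 // exprVn mulrC.
  case: leqP => h /=; last by rewrite divr_ge0 ?exprn_ge0 ?ltW.
  by rewrite ler_pdivlMr ?exprn_gt0 // mul1r ler_wiXn2l ?(ltW s1') // gerBl ltW.
by apply: sumr_ge0 => o _; rewrite mulr_ge0 ?joint_ge0 ?exprn_ge0 // ltW.
Qed.

End JointBernoulli.

(** * Privacy and accuracy of abstract protocols *)
Section Protocols.
Variables (R : realType) (n : nat).
Local Notation msg := {set 'I_n}.
Local Notation round := {ffun 'I_n -> msg}.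
Implicit Types (th : transcript n -> 'I_n -> {set 'I_n} -> 'I_n -> R).

Definition code (A : msg) : nat := enum_rank A.

Lemma code_inj : injective code.
Proof. by move=> A B /ord_inj /enum_rank_inj. Qed.

Definition encode (o : round) : {ffun 'I_n -> nat} := [ffun v => code (o v)].

Lemma encode_inj : injective encode.
Proof. by move=> o o' /ffunP E; apply/ffunP => v; have := E v; rewrite !ffunE => /code_inj. Qed.

Definition samples (mu : probability nat R) (p : 'I_n -> R) : Prop :=
  forall Y : set nat, mu Y = (\sum_A subset_pmf p A * \1_Y (code A))%:E.

Definition dp_bound (e : R) (th : {set 'I_n} -> 'I_n -> R) : Prop :=
  forall N N' A, differ_by_one N N' ->
    subset_pmf (th N) A <= expR e * subset_pmf (th N') A.

Lemma samples_le (mu mu' : probability nat R) p p' (e : R) (Y : set nat) :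
  samples mu p -> samples mu' p' ->
  (forall A, subset_pmf p A <= expR e * subset_pmf p' A) ->
  (mu Y <= (expR e)%:E * mu' Y)%E.
Proof.
move=> -> -> h; rewrite -EFinM lee_fin mulr_sumr; apply: ler_sum => A _.
by rewrite mulrA ler_wpM2r.
Qed.

Lemma randomizer_exists (th : {set 'I_n} -> 'I_n -> R) (e : R) :
  (forall N u, 0 <= th N u <= 1) -> 0 <= e -> dp_bound e th ->
  exists r : local_randomizer R n, forall N, samples (r N) (th N).
Proof.
move=> th01 e0 dp.
have /choice[r rP] : forall N : {set 'I_n}, exists mu : probability nat R, samples mu (th N).
  move=> N; apply: prob_of_pmf; last exact: sum_subset_pmf.
  by move=> A; apply: subset_pmf_ge0.
have rdp : exists2 eps0 : R, 0 <= eps0 & forall (A A' : {set 'I_n}) (Y : set nat),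
    differ_by_one A A' -> (r A Y <= (expR eps0)%:E * r A' Y)%E.
  by exists e => // A A' Y d; apply: samples_le (rP _) (rP _) _ => B; apply: dp.
by exists (LocalRandomizer rdp).
Qed.

(** Halting depends on the length of the transcript alone. The laws are prescribed for every past,
    including messages that encode no set. *)
Definition implements (P : protocol R n) (T : nat) th : Prop :=
  forall past, if (size past < T)%N
    then exists2 r, P past = Some r & forall v N, samples (r v N) (th past v N)
    else P past = None.

Lemma protocol_exists (T : nat) th (e : R) :
  (forall past v N u, 0 <= th past v N u <= 1) -> 0 <= e ->
  (forall past v, dp_bound e (th past v)) ->
  exists P, implements P T th.
Proof.
move=> th01 e0 dp.
have /choice[r rP] : forall pv : transcript n * 'I_n, exists r : local_randomizer R n,
    forall N, samples (r N) (th pv.1 pv.2 N).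
  by move=> [past v]; apply: randomizer_exists e0 _ => //=.
exists (fun past => if (size past < T)%N then Some (fun v => r (past, v)) else None).
move=> past; case: ltnP => // pT; exists (fun v => r (past, v)); first by [].
by move=> v N; apply: (rP (past, v)).
Qed.

Lemma implements_terminates P T th (K : R) :
  implements P T th -> T%:R <= K -> terminates_within K P.
Proof.
move=> PT TK tau run; apply: le_trans TK; rewrite ler_nat leqNgt; apply/negP => Tt.
have := run _ Tt; have := PT (take T tau).
by rewrite size_take Tt ltnn => ->.
Qed.

Lemma fine_samples (mu : probability nat R) p A :
  samples mu p -> fine (mu [set code A]%classic) = subset_pmf p A.
Proof. exact/fine_sum_set1/code_inj. Qed.

Lemma fine_prob_ge0 (mu : probability nat R) (Y : set nat) : 0 <= fine (mu Y).
Proof. by rewrite fine_ge0. Qed.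

Lemma run_prob_ge0 (P : protocol R n) (G : graph n) past rest : 0 <= run_prob P G past rest.
Proof.
elim: rest past => [|o rest IH] past /=; case: (P past) => // r.
by rewrite mulr_ge0 // prodr_ge0 // => v _; apply: fine_prob_ge0.
Qed.

(** * Composition of privacy losses *)

Section Privacy.
Variables (P : protocol R n) (T : nat) (th : transcript n -> 'I_n -> {set 'I_n} -> 'I_n -> R).
Variables (G G' : graph n) (c : nat -> 'I_n -> R).
Hypothesis Pth : implements P T th.
Hypothesis c_ge0 : forall i v, 0 <= c i v.
Hypothesis round_dp : forall past v A, (size past < T)%N ->
  subset_pmf (th past v (nbhd G v)) A <=
    expR (c (size past) v) * subset_pmf (th past v (nbhd G' v)) A.

(** The probability of an execution is a product over rounds and nodes, so the losses add up. The
    loss [c i v] is specific to the pair [G], [G']: nodes away from the differing edge can be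
    charged 0, which avoids a factor [n]. *)
Lemma run_prob_dp past rest :
  run_prob P G past rest <=
  expR (\sum_(size past <= i < T) \sum_v c i v) * run_prob P G' past rest.
Proof.
elim: rest past => [|o rest IH] past /=.
  case: (P past) => [r|]; first by rewrite mulr0.
  by rewrite mulr1 -expR0 ler_expR sumr_ge0 // => i _; apply: sumr_ge0.
have := Pth past; case: ltnP => sT; last by move=> ->; rewrite mulr0.
move=> [r -> rP]; rewrite big_ltn // expRD expR_sum mulrACA -big_split /=.
apply: ler_pM; rewrite ?run_prob_ge0 ?prodr_ge0 //.
- by move=> v _; apply: fine_prob_ge0.
- apply: ler_prod => v _; rewrite fine_prob_ge0 /=.
  have := samples_le [set o v]%classic (rP v (nbhd G v)) (rP v (nbhd G' v)) (fun A => round_dp v A sT).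
  have fin mu' Y : (mu' : probability nat R) Y \is a fin_num by apply: fin_num_measure.
  by rewrite -[X in (X <= _)%E]fineK // -[X in (_ * X)%E]fineK // -EFinM lee_fin.
- by have := IH (rcons past o); rewrite size_rcons.
Qed.

Lemma transcript_prob_dp (E : set (transcript n)) (eps : R) :
  \sum_(0 <= i < T) \sum_v c i v <= eps ->
  (transcript_prob P G E <= (expR eps)%:E * transcript_prob P G' E)%E.
Proof.
move=> ceps; rewrite /transcript_prob.
apply: ub_ereal_sup => _ [A fA <-].
apply: (@le_trans _ _ ((expR eps)%:E * \sum_(x \in A) (run_prob P G' [::] x)%:E)%E).
  rewrite ge0_mule_fsumr; last by move=> x; rewrite lee_fin run_prob_ge0.
  apply: lee_fsum; first by case: fA.
  move=> tau _; rewrite -EFinM lee_fin; apply: le_trans (run_prob_dp _ _) _.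
  by rewrite ler_wpM2r ?run_prob_ge0 // ler_expR.
rewrite lee_wpmul2l ?lee_fin ?expR_ge0 //.
by apply: ereal_sup_ubound; exists A.
Qed.

End Privacy.

(** * Failure probabilities of an invariant add up over rounds *)

Section Accuracy.
Variables (P : protocol R n) (T : nat) (th : transcript n -> 'I_n -> {set 'I_n} -> 'I_n -> R).
Variables (G : graph n) (E : set (transcript n)) (I : seq round -> Prop) (beta : nat -> R).
Hypothesis Pth : implements P T th.
Hypothesis th01 : forall past v N u, 0 <= th past v N u <= 1.
Hypothesis beta_ge0 : forall i, 0 <= beta i.

Definition round_law (p : seq round) : 'I_n -> 'I_n -> R :=
  fun v => th (map encode p) v (nbhd G v).

Hypothesis I_step : forall p, (size p < T)%N -> I p ->
  \sum_o joint (round_law p) o * (~~ `[< I (rcons p o) >])%:R <= beta (size p).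
Hypothesis I_E : forall p, size p = T -> I p -> E (map encode p).

Fixpoint all_rounds (k : nat) : seq (seq round) :=
  if k is k'.+1 then [seq o :: r | o <- enum [set: round], r <- all_rounds k'] else [:: [::]].

Lemma all_rounds_uniq k : uniq (all_rounds k).
Proof.
elim: k => //= k IH; apply: allpairs_uniq => //; first exact: enum_uniq.
by case=> x r [y s] /= _ _ [-> ->].
Qed.

(** Conditional probability, given the rounds [p], of ending in [E] after [k] more rounds. The sum
    ranges over encoded rounds only, which keeps it finite. *)
Definition success (k : nat) (p : seq round) : R :=
  \sum_(r <- all_rounds k)
     run_prob P G (map encode p) (map encode r) * \1_E (map encode (p ++ r)).

Lemma success_ge0 k p : 0 <= success k p.
Proof. by apply: sumr_ge0 => r _; rewrite mulr_ge0 ?run_prob_ge0. Qed.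

Lemma successS k p : (size p < T)%N ->
  success k.+1 p = \sum_o joint (round_law p) o * success k (rcons p o).
Proof.
move=> pT; rewrite /success /= big_allpairs_dep /= big_enum /=.
apply: eq_big => [x|x _]; first by rewrite inE.
rewrite mulr_sumr; apply: eq_bigr => r _.
have := Pth (map encode p); rewrite size_map pT => -[rd -> rdP].
rewrite -map_rcons cat_rcons mulrA; congr (_ * _ * _).
by apply: eq_bigr => v _; rewrite ffunE (fine_samples _ (rdP _ _)).
Qed.

Lemma success_lower k p : (size p + k)%N = T -> I p ->
  1 - \sum_(size p <= i < T) beta i <= success k p.
Proof.
elim: k p => [|k IH] p pk Ip.
  rewrite addn0 in pk; rewrite pk big_geq // subr0 /success /= big_seq1 /= cats0.
  have := Pth (map encode p); rewrite size_map pk ltnn => ->.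
  by rewrite mul1r indicE mem_set //; apply: I_E.
have pT : (size p < T)%N by rewrite -pk addnS ltnS leq_addr.
rewrite successS // big_ltn //.
set B := \sum_(_ <= i < T) _.
have B0 : 0 <= B by apply: sumr_ge0 => i _.
(* If the invariant survives the round, the induction hypothesis gives [1 - B]; otherwise the bound
   is at most 0, because [B] is nonnegative. *)
apply: (@le_trans _ _ (\sum_o joint (round_law p) o * (1 - B - (~~ `[< I (rcons p o) >])%:R))).
  under eq_bigr do rewrite mulrBr.
  rewrite sumrB -mulr_suml sum_joint mul1r.
  by have := I_step pT Ip; rewrite -/B; lra.
apply: ler_sum => o _; rewrite ler_wpM2l ?joint_ge0 //; first by move=> *; apply: th01.
case: asboolP => [Io|_] /=.
  rewrite subr0; have := IH (rcons p o); rewrite size_rcons; apply => //.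
  by rewrite -pk addnS addSn.
by have := success_ge0 k (rcons p o); lra.
Qed.

Lemma transcript_prob_lower : I [::] ->
  ((1 - \sum_(0 <= i < T) beta i)%:E <= transcript_prob P G E)%E.
Proof.
move=> I0; have := @success_lower T [::] (add0n _) I0; rewrite -lee_fin => /le_trans; apply.
rewrite /success /transcript_prob -(big_map (map encode) xpredT (fun t => run_prob P G [::] t * \1_E t)).
apply: esum_ge_seq; last by move=> t; apply: run_prob_ge0.
by rewrite map_inj_uniq ?all_rounds_uniq //; apply/inj_map/encode_inj.
Qed.

End Accuracy.
End Protocols.

(** * Multiplicative growth *)
Section Growth.
Variables (R : realType) (n : nat).
Implicit Types (x : 'I_n -> 'I_n -> R) (bit : nat -> 'I_n -> bool) (el : rel 'I_n).

(* The round in which [v] first sends the bit [true], capped at [t]. *)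
Fixpoint level bit (t : nat) (v : 'I_n) : nat :=
  if t is t'.+1 then
    if (level bit t' v == t') && ~~ bit t' v then t else level bit t' v
  else 0%N.

Definition growth (k : nat) : R := Num.min 1 ((101 / 100) ^+ k / n%:R).

(** Closed form of the iterated growth: an eligible edge stops at the smaller level of its
    endpoints. The base [x] lets phase 2 start from the result of phase 1. *)
Definition raise x el bit (t : nat) (u v : 'I_n) : R :=
  if el u v then Num.min 1 (x u v + growth (minn (level bit t u) (level bit t v)))
  else x u v.

Definition vload x (N : {set 'I_n}) (v : 'I_n) : R := \sum_(u in N) x u v.

Lemma eq_level bit bit' t v :
  (forall i, (i < t)%N -> bit i v = bit' i v) -> level bit t v = level bit' t v.
Proof.
elim: t => //= t IH E; rewrite E // IH // => i it.
by rewrite E // ltnW.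
Qed.

Lemma level_le bit t v : (level bit t v <= t)%N.
Proof. by elim: t => //= t IH; case: ifP => // _; apply: leqW. Qed.

(** Levels at an earlier time are truncations of later ones, so comparing two times becomes
    arithmetic with [minn]. *)
Lemma level_minn bit s t v : (t <= s)%N -> level bit t v = minn t (level bit s v).
Proof.
elim: s => [|s IH]; first by rewrite leqn0 => /eqP ->.
rewrite leq_eqVlt ltnS => /orP[/eqP ->|ts].
  by have := level_le bit s.+1 v; lia.
rewrite (IH ts) /=; have := level_le bit s v.
by case: ifP => // /andP[/eqP -> _]; lia.
Qed.

Lemma level_frozen bit t v : (level bit t v < t)%N -> bit (level bit t v) v.
Proof.
elim: t => //= t IH; case: ifP => [_|]; first by rewrite ltnn.
move=> /negbT; rewrite negb_and negbK => /orP[ne|b] lt.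
  by apply: IH; rewrite ltn_neqAle ne level_le.
have := level_le bit t v; rewrite leq_eqVlt => /orP[/eqP -> //|]; exact: IH.
Qed.

Lemma level_active bit t v k : level bit t v = k.+1 -> ~~ bit k v.
Proof.
elim: t => //= t IH; case: ifP => [/andP[_ nb] [<-] //|_]; exact: IH.
Qed.

Lemma growth_ge0 k : 0 <= growth k.
Proof. by rewrite /growth le_min ler01 divr_ge0 ?exprn_ge0 ?ler0n //; lra. Qed.

Lemma growthS k : growth k.+1 <= 101 / 100 * growth k.
Proof.
rewrite /growth exprS -mulrA; set a := _ / n%:R.
have : 0 <= a by rewrite divr_ge0 ?exprn_ge0 ?ler0n //; lra.
by rewrite /Num.min; case: ltP => h1; case: ltP => h2; lra.
Qed.

Lemma growth_homo : {homo growth : k l / (k <= l)%N >-> k <= l}.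
Proof.
move=> k l kl; rewrite /growth le_min ge_min lexx /= ge_min.
by apply/orP; right; rewrite ler_wpM2r ?invr_ge0 ?ler0n // ler_weXn2l //; lra.
Qed.

Lemma raise_sym x el bit t u v :
  (forall u v, x u v = x v u) -> (forall u v, el u v = el v u) ->
  raise x el bit t u v = raise x el bit t v u.
Proof. by move=> xs es; rewrite /raise minnC es xs. Qed.

Lemma raise_range x el bit t u v : 0 <= x u v <= 1 ->
  x u v <= raise x el bit t u v <= 1.
Proof.
move=> /andP[x0 x1]; rewrite /raise; case: ifP => _; last by rewrite lexx.
by rewrite le_min x1 lerDl growth_ge0 /= ge_min lexx.
Qed.

Lemma raise_homo x el bit s t u v : (t <= s)%N ->
  raise x el bit t u v <= raise x el bit s u v.
Proof.
move=> ts; rewrite /raise; case: ifP => // _.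
rewrite le_min ge_min lexx /= ge_min; apply/orP; right.
rewrite lerD2l growth_homo // !(level_minn bit _ ts); lia.
Qed.

Section Phase.
Variables (N : 'I_n -> {set 'I_n}) (x : 'I_n -> 'I_n -> R) (el : rel 'I_n).
Variables (bit : nat -> 'I_n -> bool) (T : nat) (lo hi : R).
Hypothesis n_gt0 : (0 < n)%N.
Hypothesis x01 : forall u v, 0 <= x u v <= 1.
Hypothesis bit_ok : forall t v, (t < T)%N ->
  if bit t v then lo <= vload (raise x el bit t) (N v) v
  else vload (raise x el bit t) (N v) v <= hi.
Hypothesis init_ok : forall v, vload x (N v) v + 1 <= hi.

(** The bit at the freezing round certifies the load at that time, and values never decrease
    afterwards. *)
Lemma frozen_load v : (level bit T v < T)%N -> lo <= vload (raise x el bit T) (N v) v.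
Proof.
move=> lT; have := bit_ok v lT; rewrite level_frozen // => /le_trans; apply.
by apply: ler_sum => u _; apply/raise_homo/ltnW.
Qed.

(** At level [k.+1] the bit of round [k] was false, so the load was at most [hi], and each edge at
    [v] makes at most one more growth step. At level 0 each edge gains at most [1/n], in total at
    most 1, which [init_ok] absorbs. *)
Lemma phase_load v : vload (raise x el bit T) (N v) v <= 101 / 100 * hi.
Proof.
have x0 u w : 0 <= x u w by have /andP[] := x01 u w.
have hi0 : 0 <= hi.
  by apply: le_trans (init_ok v); rewrite addr_ge0 // sumr_ge0.
case E : (level bit T v) => [|k].
  apply: (@le_trans _ _ (vload x (N v) v + \sum_(u in N v) n%:R^-1)).
    rewrite -big_split /=; apply: ler_sum => u _; rewrite /raise E minn0.
    case: ifP => _; last by rewrite lerDl invr_ge0 ler0n.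
    by rewrite ge_min lerD2l /growth expr0 mul1r ge_min lexx !orbT.
  apply: (@le_trans _ _ hi); last by lra.
  apply: le_trans (init_ok v); rewrite lerD2l sumr_const -[leLHS]mulr_natr mulrC.
  rewrite ler_pdivrMr ?ltr0n // mul1r ler_nat.
  by apply: leq_trans (max_card _) _; rewrite card_ord.
have kT : (k < T)%N by rewrite -E level_le.
have := bit_ok v kT; rewrite (negbTE (level_active E)) => loadk.
apply: (@le_trans _ _ (101 / 100 * vload (raise x el bit k) (N v) v)); last first.
  by apply: ler_wpM2l => //; lra.
rewrite mulr_sumr; apply: ler_sum => u _; rewrite /raise.
case: ifP => _; last by have := x0 u v; lra.
rewrite !(level_minn bit _ (ltnW kT)) E.
(* [m] is the final exponent of the edge and [m'] its exponent at time [k]; as [v] stops at [k.+1],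
   [m] is at most [m'.+1]. *)
set m := minn (level _ _ _) _; set m' := minn (minn _ _) _.
have : growth m <= growth m'.+1 by apply: growth_homo; rewrite /m /m'; lia.
have := growthS m'; have := growth_ge0 m'; have := x0 u v.
by rewrite /Num.min; case: ltP => h1; case: ltP => h2; lra.
Qed.

Lemma phase_saturated u v : n%:R <= (101 / 100) ^+ T :> R -> el u v ->
  level bit T u = T -> level bit T v = T -> raise x el bit T u v = 1.
Proof.
move=> nT euv lu lv; rewrite /raise euv lu lv minnn.
have -> : growth T = 1 by rewrite /growth min_l // ler_pdivlMr ?mul1r ?ltr0n.
by rewrite min_l // lerDr; have /andP[] := x01 u v.
Qed.

End Phase.
End Growth.

(** * Orientations and degree counts *)
Section GraphCounting.
Variable n : nat.
Implicit Types (G : graph n) (F : {set {set 'I_n}}) (u v : 'I_n).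

Lemma in_nbhd G u v : (u \in nbhd G v) = ([set u; v]%SET \in edges G).
Proof. by rewrite inE. Qed.

Lemma nbhd_sym G u v : (u \in nbhd G v) = (v \in nbhd G u).
Proof. by rewrite !in_nbhd finset.setUC. Qed.

Lemma nbhd_neq G u v : u \in nbhd G v -> u != v.
Proof. by rewrite in_nbhd => /edges_card2; rewrite cards2; case: eqP. Qed.

Lemma degree_inE F v : (forall e, e \in F -> #|e| = 2%N) ->
  degree_in F v = (\sum_u ([set u; v]%SET \in F))%N.
Proof.
move=> F2; rewrite /degree_in.
have -> : [set e in F | v \in e]%SET =
    [set [set u; v]%SET | u in [set u | [set u; v]%SET \in F]%SET]%SET.
  apply/setP => e; rewrite inE; apply/andP/imsetP => [[eF ve]|[u]].
    have /eqP/cards2P[a [b [ab eE]]] := F2 _ eF; move: ve eF; rewrite eE !inE.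
    move=> /orP[] /eqP -> abF; last by exists a; rewrite ?inE.
    by exists b; rewrite ?inE finset.setUC.
  by rewrite inE => uvF ->; rewrite uvF !inE eqxx orbT.
rewrite card_in_imset => [|u w]; last first.
  rewrite !inE => /F2 uv /F2 wv /setP /(_ u).
  rewrite !inE eqxx /=; move: uv; rewrite cards2.
  by case: (u =P v) => // _ _; rewrite orbF => /esym /eqP.
by rewrite -sum1dep_card big_mkcond /=; apply: eq_bigr => u _; case: (_ \in _).
Qed.

Lemma sum_degree_in F : (forall e, e \in F -> #|e| = 2%N) ->
  (\sum_v degree_in F v = 2 * #|F|)%N.
Proof.
move=> F2.
under eq_bigr do rewrite /degree_in -sum1dep_card.
rewrite (exchange_big_dep (mem F)) /=; last by move=> v e _ /andP[].
rewrite mulnC -sum_nat_const; apply: eq_bigr => e eF.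
rewrite -(F2 _ eF) -sum1_card; apply: eq_bigl => v; by rewrite eF.
Qed.

(** Each edge is listed once, smaller endpoint first, so that a single coin decides it and distinct
    edges use independent coins. *)
Definition oriented G : {set 'I_n * 'I_n} :=
  [set p : 'I_n * 'I_n | (p.1 < p.2)%N && (p.2 \in nbhd G p.1)].

Definition orient (v u : 'I_n) : 'I_n * 'I_n := if (u < v)%N then (u, v) else (v, u).

Definition incident G v : {set 'I_n * 'I_n} := [set orient v u | u in nbhd G v]%SET.

Section Sums.
Variables (R : realType) (f : 'I_n -> 'I_n -> R).
Hypothesis f_sym : forall u v, f u v = f v u.

Lemma sum_incident G v : \sum_(p in incident G v) f p.1 p.2 = \sum_(u in nbhd G v) f u v.
Proof.
rewrite big_imset /=; last first.
  move=> u w _ _; rewrite /orient; case: ifP => uv; case: ifP => wv [] //.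
    by move=> uv' _; move: uv; rewrite uv' ltnn.
  by move=> vw; move: wv; rewrite -vw ltnn.
by apply: eq_bigr => u _; rewrite /orient; case: ifP.
Qed.

Lemma sum_oriented G :
  \sum_v \sum_(u in nbhd G v) f u v = 2 * \sum_(p in oriented G) f p.1 p.2.
Proof.
have -> : \sum_(p in oriented G) f p.1 p.2 =
    \sum_v \sum_(u in nbhd G v | (v < u)%N) f v u.
  by rewrite pair_big_dep /=; apply: eq_bigl => -[a b]; rewrite !inE /= andbC.
have swap : \sum_v \sum_(u in nbhd G v | (v < u)%N) f v u =
    \sum_v \sum_(u in nbhd G v | (u < v)%N) f v u.
  rewrite (exchange_big_dep xpredT) //=; apply: eq_bigr => v _.
  by apply: eq_big => [u|u _]; [rewrite nbhd_sym | rewrite f_sym].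
rewrite mulr_natl mulr2n {2}swap -big_split /=; apply: eq_bigr => v _.
rewrite (bigID (fun u : 'I_n => (v < u)%N)) /=; congr (_ + _).
  by apply: eq_bigr => u _; rewrite f_sym.
apply: eq_big => [u|u _]; last by rewrite f_sym.
case: (boolP (u \in nbhd G v)) => //= /nbhd_neq uv.
by rewrite -leqNgt leq_eqVlt (inj_eq val_inj) (negbTE uv).
Qed.

End Sums.

Section Rounded.
Variables (R : realType) (G : graph n) (o : {ffun 'I_n -> {set 'I_n}}).

Definition forward (v : 'I_n) : {set 'I_n} := [set u in o v | (v < u)%N]%SET.

Definition chosen (u v : 'I_n) : bool := if (u < v)%N then v \in o u else u \in o v.

Lemma chosen_sym u v : u != v -> chosen u v = chosen v u.
Proof. by move=> uv; rewrite /chosen; case: ltngtP => // /ord_inj /eqP; rewrite (negbTE uv). Qed.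

Lemma in_implicit_edges u v : u != v ->
  ([set u; v]%SET \in implicit_edges forward) = chosen u v.
Proof.
move=> uv; rewrite inE; apply/existsP/idP => [[a /existsP[b /and3P[/eqP E ab h]]]|ch].
  have ch : chosen a b.
    rewrite /chosen; move: h; rewrite !inE.
    by case: ltngtP; rewrite ?andbF ?andbT ?orbF //= => /ord_inj ab'; rewrite ab' eqxx in ab.
  have /setP /(_ a) := E; have /setP /(_ b) := E; rewrite !inE !eqxx orbT /=.
  move=> /orP[] /eqP bu /orP[] /eqP au; move: ab ch; rewrite au bu ?eqxx // => _.
  by rewrite (chosen_sym uv).
exists u; apply/existsP; exists v; rewrite eqxx uv !inE /=.
by move: ch; rewrite /chosen; case: ltngtP => [_ ->|_ ->|/ord_inj /eqP]; rewrite ?andbF ?orbT // (negbTE uv).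
Qed.

Let rounded := edges G :&: implicit_edges forward.

Lemma rounded_card2 e : e \in rounded -> #|e| = 2%N.
Proof. by rewrite inE => /andP[/edges_card2]. Qed.

Lemma chosen_incident v :
  (degree_in rounded v)%:R = \sum_(u in nbhd G v) (chosen u v)%:R :> R.
Proof.
rewrite (degree_inE _ rounded_card2) natr_sum [RHS]big_mkcond /=.
apply: eq_bigr => u _; rewrite inE -in_nbhd.
case: (boolP (u \in nbhd G v)) => //= /nbhd_neq uv.
by rewrite in_implicit_edges.
Qed.

Lemma hitsE (J : {set 'I_n * 'I_n}) : J \subset oriented G ->
  (hits J o)%:R = \sum_(p in J) (chosen p.1 p.2)%:R :> R.
Proof.
move=> /fintype.subsetP JG; rewrite /hits -sum1dep_card natr_sum big_mkcondr /=.
apply: eq_bigr => -[a b] /JG; rewrite inE /= => /andP[ab _].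
by rewrite /chosen ab; case: (_ \in _).
Qed.

Lemma incident_oriented v : incident G v \subset oriented G.
Proof.
apply/fintype.subsetP => _ /imsetP[u uv ->]; rewrite inE /orient.
case: (ltnP u v) => /= h; first by rewrite h nbhd_sym.
by rewrite uv andbT ltn_neqAle h andbT eq_sym (inj_eq val_inj) (nbhd_neq uv).
Qed.

Let chosen' u v : R := if u == v then 0 else (chosen u v)%:R.

Let chosen'_sym u v : chosen' u v = chosen' v u.
Proof. by rewrite /chosen' eq_sym; case: eqP => // /eqP vu; rewrite chosen_sym // eq_sym. Qed.

Let chosen'E u v : u \in nbhd G v -> chosen' u v = (chosen u v)%:R.
Proof. by move=> /nbhd_neq; rewrite /chosen' => /negbTE ->. Qed.

Let chosen'J (J : {set 'I_n * 'I_n}) : J \subset oriented G ->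
  \sum_(p in J) chosen' p.1 p.2 = (hits J o)%:R.
Proof.
move=> JG; rewrite hitsE //; apply: eq_bigr => p /(fintype.subsetP JG).
by rewrite inE nbhd_sym => /andP[_ /chosen'E].
Qed.

(** Degrees, and below the size, become counts of independent coins, to which the Chernoff bounds
    apply. *)
Lemma degree_rounded v : degree_in rounded v = hits (incident G v) o.
Proof.
apply/eqP; rewrite -(eqr_nat R) chosen_incident -chosen'J ?incident_oriented //.
by rewrite sum_incident //; apply/eqP/eq_bigr => u uv; rewrite chosen'E.
Qed.

Lemma card_rounded : #|rounded| = hits (oriented G) o.
Proof.
apply/eqP; rewrite -(eqr_nat R) -chosen'J //.
have two : 2 != 0 :> R by rewrite pnatr_eq0.
rewrite -(inj_eq (mulfI two)) -sum_oriented // -natrM -sum_degree_in; last exact: rounded_card2.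
rewrite natr_sum; apply/eqP/eq_bigr => v _; rewrite chosen_incident.
by apply: eq_bigr => u uv; rewrite chosen'E.
Qed.

End Rounded.
End GraphCounting.

(** * The two-phase fractional matching *)
Section TwoPhases.
Variables (R : realType) (n T : nat).
Implicit Types (bit : nat -> 'I_n -> bool).

Definition frozen bit (v : 'I_n) : bool := (level bit T v < T)%N.

Definition weight1 bit (t : nat) : 'I_n -> 'I_n -> R :=
  raise (fun _ _ => 0) (fun _ _ => true) bit t.

Definition second_half bit : nat -> 'I_n -> bool := fun t => bit (T + t)%N.

Definition weight2 bit (t : nat) : 'I_n -> 'I_n -> R :=
  raise (weight1 bit T) (fun u v => frozen bit u != frozen bit v) (second_half bit) t.

Definition weight bit (t : nat) : 'I_n -> 'I_n -> R :=
  if (t < T)%N then weight1 bit t else weight2 bit (t - T).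

Definition threshold (b : R) (t : nat) : R :=
  if (t < T)%N then 58 / 100 * b else 97 / 100 * b.

(** Causality: the weights at time [t] depend only on earlier bits. Hence the nodes can compute them
    from the transcript, and appending rounds does not alter them. *)
Lemma eq_weight bit bit' t :
  (forall i v, (i < t)%N -> bit i v = bit' i v) -> weight bit t = weight bit' t.
Proof.
move=> E; apply/funext => u; apply/funext => v; rewrite /weight; case: ltnP => tT.
  by rewrite /weight1 /raise !(@eq_level _ bit bit' t) // => i it; apply: E.
have E1 w : level bit T w = level bit' T w.
  by apply: eq_level => i iT; apply/E/(leq_trans iT).
have E2 w : level (second_half bit) (t - T) w = level (second_half bit') (t - T) w.
  by apply: eq_level => i it; apply: E; rewrite -ltn_subRL.
by rewrite /weight2 /raise /frozen /weight1 /raise !E1 !E2.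
Qed.

Lemma weight1_range bit t u v : 0 <= weight1 bit t u v <= 1.
Proof. by apply: raise_range; rewrite lexx ler01. Qed.

Lemma weight2_range bit t u v : weight1 bit T u v <= weight2 bit t u v <= 1.
Proof. exact/raise_range/weight1_range. Qed.

Lemma weight_range bit t u v : 0 <= weight bit t u v <= 1.
Proof.
rewrite /weight; case: ifP => _; first exact: weight1_range.
have /andP[a _] := weight1_range bit T u v; have /andP[c d] := weight2_range bit (t - T) u v.
by rewrite d (le_trans a c).
Qed.

Lemma weight_sym bit t u v : weight bit t u v = weight bit t v u.
Proof.
have s1 s u' v' : weight1 bit s u' v' = weight1 bit s v' u' by apply: raise_sym.
rewrite /weight; case: ifP => _ //; apply: raise_sym => // u' v'.
by rewrite eq_sym.
Qed.

Section Value.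
Variables (G : graph n) (b : R) (bit : nat -> 'I_n -> bool).
Hypothesis n_gt0 : (0 < n)%N.
Hypothesis nT : n%:R <= (101 / 100) ^+ T :> R.
Hypothesis b_ge : 100 <= b.
Hypothesis bit_ok : forall t v, (t < 2 * T)%N ->
  if bit t v then threshold b t - b / 100 <= vload (weight bit t) (nbhd G v) v
  else vload (weight bit t) (nbhd G v) v <= threshold b t + b / 100.

Local Notation x1 := (weight1 bit T).
Local Notation x2 := (weight2 bit T).
Local Notation H := (frozen bit).
Local Notation K := (frozen (second_half bit)).

Lemma weight_end : weight bit (2 * T) = x2.
Proof. by rewrite /weight ltnNge leq_pmull //= mul2n -addnn addnK. Qed.

Let bit_ok1 t v : (t < T)%N ->
  if bit t v then 57 / 100 * b <= vload (weight1 bit t) (nbhd G v) v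
  else vload (weight1 bit t) (nbhd G v) v <= 59 / 100 * b.
Proof.
move=> tT; have := @bit_ok t v; rewrite /threshold /weight tT => /(_ ltac:(lia)).
by case: (bit t v) => h; lra.
Qed.

Let bit_ok2 t v : (t < T)%N ->
  if second_half bit t v then 96 / 100 * b <= vload (weight2 bit t) (nbhd G v) v
  else vload (weight2 bit t) (nbhd G v) v <= 98 / 100 * b.
Proof.
move=> tT; have := @bit_ok (T + t)%N v; have tT' : (T + t < T)%N = false by lia.
rewrite /threshold /weight tT' addKn => /(_ ltac:(lia)); rewrite /second_half.
by case: (bit _ v) => h; lra.
Qed.

Lemma weight1_load v : vload x1 (nbhd G v) v <= 596 / 1000 * b.
Proof.
have bge := b_ge; have key : 101 / 100 * (59 / 100 * b) <= 596 / 1000 * b by lra.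
apply: le_trans key; apply: (phase_load n_gt0 _ bit_ok1); first by move=> *; rewrite lexx ler01.
by move=> w; rewrite /vload big1 //; lra.
Qed.

Let init2 v : vload x1 (nbhd G v) v + 1 <= 98 / 100 * b.
Proof. by have bge := b_ge; have := weight1_load v; lra. Qed.

(** The overshoot gives [1.01 * 0.98 = 0.9898]; the remaining 1% of [b] is room for the rounding. *)
Lemma weight2_load v : vload x2 (nbhd G v) v <= 99 / 100 * b.
Proof.
apply: le_trans (phase_load n_gt0 (weight1_range bit T) bit_ok2 init2 v) _.
by have bge := b_ge; lra.
Qed.

Lemma frozen1_load v : H v -> 57 / 100 * b <= vload x1 (nbhd G v) v.
Proof. exact: (frozen_load bit_ok1). Qed.

Lemma frozen2_load v : K v -> 96 / 100 * b <= vload x2 (nbhd G v) v.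
Proof. exact: (frozen_load bit_ok2). Qed.

Lemma level_not_frozen bit' v : ~~ frozen bit' v -> level bit' T v = T.
Proof. by rewrite /frozen -leqNgt => h; apply/eqP; rewrite eqn_leq level_le. Qed.

Lemma x1_saturated u v : ~~ H u -> ~~ H v -> x1 u v = 1.
Proof.
move=> hu hv; apply: phase_saturated => //; try exact: level_not_frozen.
by move=> *; rewrite lexx ler01.
Qed.

Lemma x2_saturated u v : H u != H v -> ~~ K u -> ~~ K v -> x2 u v = 1.
Proof.
move=> huv hu hv; apply: phase_saturated => //; try exact: level_not_frozen.
exact: weight1_range.
Qed.

Lemma x2_ineligible u v : H u = H v -> x2 u v = x1 u v.
Proof. by move=> E; rewrite /weight2 {1}/raise E eqxx. Qed.

(* Dual prices: with [z = max 0 (1 - y u - y v)] on the edges, [(y, z)] is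
   feasible for the dual of the fractional b-matching linear program. *)
Definition price (v : 'I_n) : R := (H v)%:R / 2 + (K v)%:R / 2.

Definition slack (u v : 'I_n) : R := Num.max 0 (1 - price u - price v).

(* The part of [2 * x2 u v] that the edge [uv] pays to its endpoint [v]. The
   phase 2 part is split 144:56 between [H] and its complement, since a node of
   [H] gains only about 0.36 b in phase 2. *)
Definition charge (u v : 'I_n) : R :=
  if H v then x1 u v + (if K v then 144 / 100 * (x2 u v - x1 u v) else 0)
  else if K v then 56 / 100 * x2 u v else 0.

(** The slack is positive only if at most one of the four flags [H], [K] holds at the two endpoints,
    and then the edge is saturated. Otherwise the charges alone fit: inside [H] phase 2 adds
    nothing, and across the cut the shares 1.44 and 0.56 sum to 2. *)
Lemma charge_edge u v :
  charge u v + charge v u + 104 / 100 * slack u v <= 2 * x2 u v.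
Proof.
have x1s : x1 v u = x1 u v by rewrite /weight1 raise_sym.
have x2s : x2 v u = x2 u v by rewrite -weight_end weight_sym.
have /andP[a1 a2] := weight1_range bit T u v; have /andP[a3 a4] := weight2_range bit T u v.
have e1 := @x1_saturated u v; have e2 := @x2_saturated u v; have e3 := @x2_ineligible u v.
move: e1 e2 e3; rewrite /charge /slack /price x1s x2s /Num.max.
case: (H u); case: (H v); case: (K u); case: (K v) => /= e1 e2 e3;
  case: ltP => h; try (have {}e1 := e1 isT isT); try (have {}e2 := e2 isT isT isT);
  try (have {}e3 := e3 erefl); lra.
Qed.

(** In units of [b]: a node in [H] and [K] needs 1.04 and gets at least
    [1.44 * 0.96 - 0.44 * 0.596], about 1.12; with one flag it needs 0.52 and gets 0.57 ([H]) or
    [0.56 * 0.96] ([K]). *)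
Lemma charge_vertex v : 104 / 100 * b * price v <= \sum_(u in nbhd G v) charge u v.
Proof.
have bge := b_ge; have b0 : 0 <= b by lra.
have l1 := weight1_load v; have l2 := @frozen1_load v; have l3 := @frozen2_load v.
rewrite /charge /price; case: (H v) l2 => l2; case: (K v) l3 => l3 /=.
- have {}l2 := l2 isT; have {}l3 := l3 isT.
  rewrite big_split /= -mulr_sumr sumrB.
  by move: l1 l2 l3; rewrite /vload; lra.
- rewrite big_split /= big1_eq addr0; have {}l2 := l2 isT.
  by move: l2; rewrite /vload; lra.
- by rewrite -mulr_sumr; have {}l3 := l3 isT; move: l3; rewrite /vload; lra.
- by rewrite big1 //; lra.
Qed.

(** Weak duality. The vertex sum counts every edge twice, so 1.04 here is the ratio 0.52. *)
Lemma OPT_le_value (b' : nat) : b'%:R <= b ->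
  104 / 100 * (OPT b' G)%:R <= \sum_v vload x2 (nbhd G v) v.
Proof.
move=> b'b; have bge := b_ge; pose S := \sum_v \sum_(u in nbhd G v) slack u v.
have slack0 u v : 0 <= slack u v by rewrite le_max lexx.
have price0 v : 0 <= price v by rewrite addr_ge0 ?divr_ge0.
(* Summing [charge_edge] over ordered pairs counts all charges twice; halving leaves the coefficient
   0.52 on [S]. *)
have primal : 104 / 100 * b * \sum_v price v + 52 / 100 * S <= \sum_v vload x2 (nbhd G v) v.
  set Pr := \sum_v price v.
  have C1 : 104 / 100 * b * Pr <= \sum_v \sum_(u in nbhd G v) charge u v.
    by rewrite mulr_sumr; apply: ler_sum => v _; apply: charge_vertex.
  have C2 : \sum_v \sum_(u in nbhd G v) charge v u = \sum_v \sum_(u in nbhd G v) charge u v.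
    rewrite (exchange_big_dep xpredT) //=; apply: eq_bigr => v _.
    by apply: eq_bigl => u; rewrite nbhd_sym.
  have : \sum_v \sum_(u in nbhd G v) (charge u v + charge v u + 104 / 100 * slack u v)
      <= \sum_v \sum_(u in nbhd G v) 2 * x2 u v.
    by apply: ler_sum => v _; apply: ler_sum => u _; apply: charge_edge.
  under eq_bigr do rewrite !big_split /= -mulr_sumr.
  rewrite !big_split /= -mulr_sumr C2 -/S.
  under [leRHS]eq_bigr do rewrite -mulr_sumr.
  by rewrite -mulr_sumr -[\sum_v \sum_(u in nbhd G v) x2 u v]/(\sum_v vload x2 (nbhd G v) v); lra.
suff : (2 * OPT b' G)%:R <= 2 * b * \sum_v price v + S by rewrite natrM; lra.
rewrite /OPT; elim/big_ind: _ => [|p q IHp IHq|F]; first 2 last.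
- move=> /andP[/fintype.subsetP FG /forallP Fb].
  have F2 e : e \in F -> #|e| = 2%N by move=> /FG /edges_card2.
  rewrite -sum_degree_in // natr_sum.
  pose m u v : R := ([set u; v]%SET \in F)%:R.
  have mdeg v : (degree_in F v)%:R = \sum_u m u v by rewrite degree_inE // natr_sum.
  have msym u v : m u v = m v u by rewrite /m finset.setUC.
  have m0 u v : 0 <= m u v by [].
  have mG u v : u \notin nbhd G v -> m u v = 0.
    by rewrite in_nbhd /m; case: (boolP (_ \in F)) => // /FG ->.
  (* Dual feasibility: on each matching edge, the two prices and the slack sum to at least 1. *)
  apply: (@le_trans _ _ (\sum_v \sum_u (m u v * price v + m u v * price u
      + (u \in nbhd G v)%:R * slack u v))).
    apply: ler_sum => v _; rewrite mdeg; apply: ler_sum => u _.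
    case: (boolP (u \in nbhd G v)) => [_|/mG ->]; last by rewrite !mul0r !addr0.
    have : 1 - price u - price v <= slack u v by rewrite le_max lexx orbT.
    have := slack0 u v; rewrite /m; case: (_ \in F) => /=; lra.
  set Pr := \sum_v price v.
  under eq_bigr do rewrite !big_split /=.
  rewrite !big_split /=.
  have -> : \sum_v \sum_u (u \in nbhd G v)%:R * slack u v = S.
    apply: eq_bigr => v _; rewrite [RHS]big_mkcond /=; apply: eq_bigr => u _.
    by case: (_ \in _); rewrite ?mul1r ?mul0r.
  have -> : \sum_v \sum_u m u v * price u = \sum_v \sum_u m u v * price v.
    rewrite exchange_big; apply: eq_bigr => v _; apply: eq_bigr => u _.
    by rewrite msym.
  rewrite lerD2r; have -> : 2 * b * Pr = \sum_v (b * price v + b * price v).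
    by rewrite mulr_sumr; apply: eq_bigr => v _; lra.
  rewrite -big_split /=; apply: ler_sum => v _; rewrite -mulr_suml -mdeg.
  have : (degree_in F v)%:R * price v <= b * price v.
    by rewrite ler_wpM2r // (le_trans _ b'b) // ler_nat.
  lra.
- rewrite muln0; apply: addr_ge0; last by apply: sumr_ge0 => v _; apply: sumr_ge0.
  by apply: mulr_ge0; [lra | apply: sumr_ge0].
- by rewrite /maxn; case: ifP.
Qed.

(** The lower tail of the rounding needs a value of order [b]. One node frozen in phase 1 provides
    it; with none, all values are 1 and the rounding is deterministic. *)
Lemma value_alternative :
  (forall u v, x2 u v = 1) \/ 57 / 100 * b <= \sum_v vload x2 (nbhd G v) v.
Proof.
have [/existsP[v Hv]|/existsPn noH] := boolP [exists v, H v]; [right|left].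
  apply: le_trans (frozen1_load Hv) _; rewrite [leRHS](bigD1 v) //=.
  apply: (@le_trans _ _ (vload x2 (nbhd G v) v)).
    by apply: ler_sum => u _; have /andP[] := weight2_range bit T u v.
  rewrite lerDl; apply: sumr_ge0 => w _; apply: sumr_ge0 => u _.
  have /andP[a _] := weight1_range bit T u w; have /andP[c _] := weight2_range bit T u w.
  exact: le_trans a c.
move=> u v; rewrite x2_ineligible ?x1_saturated ?noH //.
by rewrite (negbTE (noH u)) (negbTE (noH v)).
Qed.

End Value.
End TwoPhases.

(** * The private algorithm *)
Section Sigmoid.
Variable R : realType.

Definition sigmoid (s : R) : R := (1 + expR (- s))^-1.

Let den_gt0 (s : R) : 0 < 1 + expR (- s).
Proof. by rewrite addr_gt0 ?expR_gt0. Qed.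

Lemma sigmoid_range s : 0 <= sigmoid s <= 1.
Proof. by rewrite /sigmoid invr_ge0 ltW //= invf_le1 // lerDl expR_ge0. Qed.

Lemma sigmoidN s : 1 - sigmoid s = sigmoid (- s).
Proof.
rewrite /sigmoid opprK; have := den_gt0 s; have := den_gt0 (- s); rewrite opprK expRN.
have := expR_gt0 s; set x := expR s => x0 h1 h2.
by field; rewrite !gt_eqF // addrC.
Qed.

Lemma sigmoid_le_expR s : sigmoid s <= expR s.
Proof.
by rewrite /sigmoid -[expR s]invrK -expRN lef_pV2 ?posrE ?expR_gt0 // lerDr ler01.
Qed.

Lemma sigmoid_ratio e s s' : 0 <= e -> s - s' <= e ->
  sigmoid s <= expR e * sigmoid s'.
Proof.
move=> e0 ss; rewrite /sigmoid ler_pdivlMr // mulrC ler_pdivrMr //.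
rewrite mulrDr mulr1 lerD //; first by rewrite -expR0 ler_expR.
by rewrite -expRD ler_expR; lra.
Qed.

(** The symmetry [sigmoidN] reduces the bit [false] to the bit [true] at the opposite argument. *)
Lemma bern_sigmoid_ratio e s s' (c : bool) : `|s - s'| <= e ->
  bern (sigmoid s) c <= expR e * bern (sigmoid s') c.
Proof.
move=> ss; have e0 : 0 <= e by apply: le_trans ss.
move: ss; rewrite ler_norml => /andP[h1 h2].
by case: c; rewrite /bern ?sigmoidN; apply: sigmoid_ratio => //; lra.
Qed.

Lemma subset_pmf_ratio (T : finType) (p p' : T -> R) (v : T) (e : R) (A : {set T}) :
  (forall u, 0 <= p' u <= 1) -> (forall u, u != v -> p u = p' u) ->
  (forall c, bern (p v) c <= expR e * bern (p' v) c) ->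
  subset_pmf p A <= expR e * subset_pmf p' A.
Proof.
move=> p01 pp h; rewrite /subset_pmf (bigD1 v) //= [in leRHS](bigD1 v) //= mulrA.
rewrite [X in _ * X <= _](eq_bigr (fun u => bern (p' u) (u \in A))) => [|u /pp -> //].
by apply: ler_wpM2r => //; apply: prodr_ge0 => u _; apply: bern_ge0.
Qed.

End Sigmoid.

Section Sensitivity.
Variables (R : realType) (n : nat).

(** The weights [x] are the same on both sides, being public functions of the transcript; only the
    set of summands changes, by one term of value at most 1. *)
Lemma vload_sensitivity (x : 'I_n -> 'I_n -> R) (N N' : {set 'I_n}) v :
  (forall u w, 0 <= x u w <= 1) -> differ_by_one N N' ->
  `|vload x N v - vload x N' v| <= 1.
Proof.
move=> x01 d.
have half (A B : {set 'I_n}) : differ_by_one A B -> vload x A v - vload x B v <= 1.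
  move=> dAB; rewrite /vload (big_setID B) /= [in X in _ - X](big_setID A) /= finset.setIC.
  rewrite opprD addrACA subrr add0r.
  have : \sum_(u in A :\: B) x u v <= 1.
    apply: (@le_trans _ _ (\sum_(u in A :\: B) 1)).
      by apply: ler_sum => u _; have /andP[] := x01 u v.
    rewrite sumr_const lern1 -dAB; exact/subset_leq_card/finset.subsetUl.
  have : 0 <= \sum_(u in B :\: A) x u v.
    by apply: sumr_ge0 => u _; have /andP[] := x01 u v.
  by lra.
rewrite ler_norml half // andbT lerNl opprB half //.
by move: d; rewrite /differ_by_one finset.setUC.
Qed.

(** Only the two ends of the differing edge [e] see a change, so each bit round costs [2 * eps']. *)
Lemma edge_neighbors_nbhd (G G' : graph n) : edge_neighbors G G' ->
  exists2 e : {set 'I_n}, #|e| = 2%N & forall v,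
    if v \in e then differ_by_one (nbhd G v) (nbhd G' v) else nbhd G v = nbhd G' v.
Proof.
move=> /eqP/cards1P[e dE]; have dP f : (f \in edges G) != (f \in edges G') = (f == e).
  by rewrite -finset.in_set1 -dE !inE; case: (f \in edges G); case: (f \in edges G').
have e2 : #|e| = 2%N.
  have := dP e; rewrite eqxx.
  case: (boolP (e \in edges G)) => [/edges_card2 //|_].
  by case: (boolP (e \in edges G')) => [/edges_card2 //|].
exists e => // v; case: ifP => ve; last first.
  apply/setP => u; rewrite !in_nbhd; apply/eqP; rewrite -[_ == _]negbK dP.
  by apply: contraFN ve => /eqP <-; rewrite !inE eqxx orbT.
have /eqP/cards2P[a [c [ac eE]]] := e2.
have [w wv ew] : exists2 w, w != v & e = [set w; v]%SET.
  move: ve; rewrite eE !inE => /orP[] /eqP ->; last by exists a.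
  by exists c; rewrite 1?eq_sym // finset.setUC.
rewrite /differ_by_one (_ : _ :|: _ = [set w]%SET) ?cards1 //.
apply/setP => u; transitivity ([set u; v]%SET == e).
  by rewrite -dP !inE; case: (_ \in edges G); case: (_ \in edges G').
rewrite ew inE; apply/eqP/eqP => [/setP /(_ w)|-> //].
by rewrite !inE eqxx (negbTE wv) orbF => /eqP.
Qed.

End Sensitivity.

Section Algorithm.
Variables (R : realType) (n T b : nat) (eps' : R).
Local Notation round := {ffun 'I_n -> {set 'I_n}}.
Implicit Types (p : seq round) (past : transcript n).

Definition decode (k : nat) : {set 'I_n} := nth finset.set0 (enum {: {set 'I_n}}) k.

Definition heard past (t : nat) (v : 'I_n) : {set 'I_n} := decode (nth [ffun=> 0%N] past t v).

Definition heard_bit past (t : nat) (v : 'I_n) : bool := v \in heard past t v.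

Definition sent_bit p (t : nat) (v : 'I_n) : bool := v \in nth [ffun=> finset.set0] p t v.

(* A message is a random set of nodes with independent memberships. In the
   first [2 * T] rounds only the membership of the sender itself is random, and
   it is the freeze bit; in the last round [u] belongs to the message of [v]
   when the coin of the pair [vu] succeeds. *)
Definition law past (v : 'I_n) (N : {set 'I_n}) (u : 'I_n) : R :=
  let t := size past in
  if (t < 2 * T)%N then
    if u == v then sigmoid (eps' * (vload (weight R T (heard_bit past) t) N v - threshold T b%:R t))
    else 0
  else weight R T (heard_bit past) (2 * T) v u.

(** Coins are tossed for all pairs; those that are not edges vanish on intersecting with
    [edges G]. *)
Definition output : decoder n := fun v tau _ => [set u in heard tau (2 * T) v | (v < u)%N]%SET.

Lemma heard_encode p t : (t < size p)%N ->
  heard (map (@encode n) p) t = nth [ffun=> finset.set0] p t.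
Proof.
move=> tp; apply/funext => v; rewrite /heard (nth_map [ffun=> finset.set0]) // ffunE /decode /code.
exact: nth_enum_rank.
Qed.

Lemma weight_heard p t : (t <= size p)%N ->
  weight R T (heard_bit (map (@encode n) p)) t = weight R T (sent_bit p) t :> ('I_n -> 'I_n -> R).
Proof.
move=> tp; apply: eq_weight => i v it.
by rewrite /heard_bit heard_encode // (leq_trans it).
Qed.

Lemma law_range past v N u : 0 <= law past v N u <= 1.
Proof.
rewrite /law; case: ifP => _; last exact: weight_range.
by case: ifP => _; [apply: sigmoid_range | rewrite lexx ler01].
Qed.

Hypothesis eps'_ge0 : 0 <= eps'.

Lemma law_dp past v : dp_bound eps' (law past v).
Proof.
move=> N N' A d; have e1 : 1 <= expR eps' by rewrite -expR0 ler_expR.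
rewrite /law; case: ltnP => _; last first.
  by rewrite ler_peMl // subset_pmf_ge0 // => u; apply: weight_range.
apply: (@subset_pmf_ratio _ _ _ _ v) => [u|u /negbTE -> //|c].
  by case: ifP => _; [apply: sigmoid_range | rewrite lexx ler01].
rewrite eqxx; apply: bern_sigmoid_ratio.
rewrite -mulrBr normrM ger0_norm // ler_piMr // opprB addrA subrK.
by apply: vload_sensitivity => // *; apply: weight_range.
Qed.

(** There are [2 * T] bit rounds with two affected nodes each. The rounding round is free, since its
    law ignores the neighborhood. *)
Lemma algorithm_dp (P : protocol R n) (eps : R) : implements P (2 * T).+1 law ->
  4 * T%:R * eps' <= eps -> is_LEDP eps P.
Proof.
move=> Pth Te G G' E /edge_neighbors_nbhd[e e2 eP].
pose c (i : nat) (v : 'I_n) : R := if (i < 2 * T)%N then eps' * (v \in e)%:R else 0.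
apply: (@transcript_prob_dp _ _ P (2 * T).+1 law G G' c) => //.
- by move=> i v; rewrite /c; case: ifP => _ //; rewrite mulr_ge0.
- move=> past v A sp; rewrite /c; have := eP v; case: ifP => [ve d|ve ->]; last first.
    by rewrite mulr0 if_same expR0 mul1r.
  rewrite mulr1; case: ifP => st; first exact: law_dp.
  by rewrite expR0 mul1r /law st.
rewrite big_nat_recr //= [X in _ + X]big1 ?addr0 => [|v _]; last by rewrite /c ltnn.
rewrite big_mkord (eq_bigr (fun=> 2 * eps')) => [|i _].
  rewrite sumr_const card_ord -[leLHS]mulr_natl natrM; apply: le_trans Te; lra.
rewrite /c ltn_ord -mulr_sumr -natr_sum mulrC; congr (_%:R * _).
by rewrite -e2 -sum1_card [RHS]big_mkcond; apply: eq_bigr => v _; case: (_ \in _).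
Qed.

(** * Accuracy of the bits and of the rounding *)

Section Run.
Variable G : graph n.
Variable b' : nat.
Hypothesis n_gt0 : (0 < n)%N.
Hypothesis nT : n%:R <= (101 / 100) ^+ T :> R.
Hypothesis b_ge : 100 <= b%:R :> R.
Hypothesis b'b : (b' <= b)%N.

Definition bit_ok p (t : nat) (v : 'I_n) : Prop :=
  if sent_bit p t v
  then threshold T b%:R t - b%:R / 100 <= vload (weight R T (sent_bit p) t) (nbhd G v) v :> R
  else vload (weight R T (sent_bit p) t) (nbhd G v) v <= threshold T b%:R t + b%:R / 100 :> R.

Definition rounding_ok (o : round) : bool :=
  [forall v, (hits (incident G v) o <= b)%N] && (OPT b' G <= 2 * hits (oriented G) o)%N.

Definition invariant p : Prop :=
  (forall t v, (t < size p)%N -> (t < 2 * T)%N -> bit_ok p t v) /\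
  (size p = (2 * T).+1 -> rounding_ok (nth [ffun=> finset.set0] p (2 * T))).

Lemma sent_bit_rcons p o t : (t < size p)%N -> sent_bit (rcons p o) t = sent_bit p t.
Proof. by move=> tp; apply/funext => v; rewrite /sent_bit nth_rcons tp. Qed.

Lemma weight_rcons p o t : (t <= size p)%N ->
  weight R T (sent_bit (rcons p o)) t = weight R T (sent_bit p) t :> ('I_n -> 'I_n -> R).
Proof. by move=> tp; apply: eq_weight => i v it; rewrite sent_bit_rcons // (leq_trans it). Qed.

Lemma bit_ok_rcons p o t v : (t < size p)%N -> bit_ok p t v -> bit_ok (rcons p o) t v.
Proof. by move=> tp; rewrite /bit_ok sent_bit_rcons // weight_rcons // ltnW. Qed.

Definition bit_error : R := expR (- (eps' * b%:R / 100)).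

Definition rounding_error : R := expR (- (b%:R / 200 / 200)).

Lemma bit_step p : (size p < 2 * T)%N -> invariant p ->
  \sum_o joint (round_law law G p) o * (~~ `[< invariant (rcons p o) >])%:R
    <= n%:R * bit_error.
Proof.
move=> pT [Ip _].
pose s v : R := vload (weight R T (sent_bit p) (size p)) (nbhd G v) v - threshold T b%:R (size p).
(* For a given [s v] at most one bit value is bad, and the logistic law gives it probability at most
   [bit_error]; the rest is a union bound over nodes. *)
pose bad v (c : bool) : bool := if c then s v < - (b%:R / 100) else b%:R / 100 < s v.
have step o : (~~ `[< invariant (rcons p o) >])%:R <=
    \sum_v \sum_(c : bool) ((v \in o v) == c)%:R * (bad v c)%:R :> R.
  case: asboolP => [_|nI] /=.
    by apply: sumr_ge0 => v _; apply: sumr_ge0 => c _; rewrite mulr_ge0.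
  have [v vbad] : exists v, bad v (v \in o v).
    apply: contrapT => none; apply: nI; split => [t v|]; last by rewrite size_rcons; lia.
    rewrite size_rcons ltnS leq_eqVlt => /orP[/eqP -> _|tp tT]; last first.
      exact/bit_ok_rcons/Ip.
    have : ~ bad v (v \in o v) by move=> h; apply: none; exists v.
    rewrite /bit_ok weight_rcons // /sent_bit nth_rcons ltnn eqxx /bad /s.
    by case: (v \in o v) => /negP; rewrite -leNgt; lra.
  rewrite (bigD1 v) //= (bigD1 (v \in o v)) //= eqxx vbad mulr1 -addrA lerDl.
  rewrite addr_ge0 //; first by apply: sumr_ge0 => c _; rewrite mulr_ge0.
  by apply: sumr_ge0 => w _; apply: sumr_ge0 => c _; rewrite mulr_ge0.
apply: (@le_trans _ _ (\sum_o joint (round_law law G p) o *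
    \sum_v \sum_(c : bool) ((v \in o v) == c)%:R * (bad v c)%:R)).
  apply: ler_sum => o _; apply: ler_wpM2l => //.
  by apply: joint_ge0 => *; apply: law_range.
have -> : n%:R * bit_error = \sum_(v < n) bit_error by rewrite sumr_const card_ord mulr_natl.
under eq_bigr do rewrite mulr_sumr.
rewrite exchange_big /=; apply: ler_sum => v _.
under eq_bigr do rewrite mulr_sumr.
rewrite exchange_big /=.
rewrite (eq_bigr (fun c : bool => bern (sigmoid (eps' * s v)) c * (bad v c)%:R)); last first.
  move=> c _; under eq_bigr do rewrite mulrA.
  rewrite -mulr_suml joint_coordinate /round_law /law size_map pT eqxx.
  by rewrite weight_heard.
rewrite big_bool /= /bern sigmoidN /bad.
have bge := b_ge; have e0 := eps'_ge0.
have [h1|h1] := boolP (s v < _); have [h2|h2] := boolP (_ < s v).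
- by lra.
- rewrite mulr1 mulr0 addr0; apply: le_trans (sigmoid_le_expR _) _.
  rewrite /bit_error ler_expR -mulrA -mulrN; apply: ler_wpM2l => //; lra.
- rewrite mulr1 mulr0 add0r; apply: le_trans (sigmoid_le_expR _) _.
  by rewrite /bit_error ler_expR lerN2 -mulrA; apply: ler_wpM2l => //; apply: ltW.
- by rewrite !mulr0 addr0 expR_ge0.
Qed.

Lemma rounding_step p : size p = (2 * T)%N -> invariant p ->
  \sum_o joint (round_law law G p) o * (~~ `[< invariant (rcons p o) >])%:R
    <= n.+1%:R * rounding_error.
Proof.
move=> pT [Ip _]; have bge := b_ge.
have ok t v : (t < 2 * T)%N -> bit_ok p t v by move=> tT; apply: Ip; rewrite ?pT.
pose x : 'I_n -> 'I_n -> R := weight R T (sent_bit p) (2 * T).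
have lawE : round_law law G p = x.
  apply/funext => v; apply/funext => u.
  by rewrite /round_law /law size_map pT ltnn weight_heard ?pT.
have x01 v u : 0 <= x v u <= 1 by apply: weight_range.
have xs u v : x u v = x v u by apply: weight_sym.
have xE : x = weight2 R T (sent_bit p) T by apply: weight_end.
rewrite lawE.
set k := (OPT b' G)./2.
pose small (o : round) := (2 * hits (oriented G) o < OPT b' G)%N.
have step o : (~~ `[< invariant (rcons p o) >])%:R <=
    \sum_v (b < hits (incident G v) o)%N%:R + (small o)%:R :> R.
  case: asboolP => [_|nI] /=; first by rewrite addr_ge0 // sumr_ge0.
  have : ~~ rounding_ok o.
    apply/negP => ro; apply: nI; split => [t v|_].
      rewrite size_rcons ltnS => _ tT; apply: bit_ok_rcons; rewrite ?pT //; exact: ok.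
    by rewrite nth_rcons pT ltnn eqxx.
  rewrite /rounding_ok negb_and => /orP[/forallPn[v]|]; rewrite -ltnNge => h.
    rewrite (bigD1 v) //= h -addrA lerDl addr_ge0 // sumr_ge0 //.
  by rewrite /small h lerDr sumr_ge0.
apply: (@le_trans _ _ (\sum_v (\sum_o joint x o * (b < hits (incident G v) o)%N%:R)
    + \sum_o joint x o * (small o)%:R)).
  rewrite exchange_big /= -big_split /=; apply: ler_sum => o _.
  by rewrite -mulr_sumr -mulrDr; apply: ler_wpM2l => //; apply: joint_ge0.
have -> : n.+1%:R * rounding_error = \sum_(v < n) rounding_error + rounding_error.
  by rewrite sumr_const card_ord -[X in _ = X + _]mulr_natl -natr1 mulrDl mul1r.
apply: lerD.
  apply: ler_sum => v _.
  (* With [s = 1/200] the gap [200/201 - 99/100] exceeds [1/200], whence the exponent of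
     [rounding_error]. *)
  have s0 : 0 < 1 / 200 :> R by lra.
  apply: le_trans (hits_upper_tail (incident G v) b x01 s0) _.
  rewrite ler_expR sum_incident // -/(vload x (nbhd G v) v).
  have : vload x (nbhd G v) v <= 99 / 100 * b%:R by rewrite xE; apply: weight2_load.
  have -> : b%:R / (1 + 1 / 200) = 200 / 201 * b%:R :> R by field.
  by lra.
have := sum_oriented xs G; set m := \sum_(q in _) _ => S2.
have SE : \sum_v vload x (nbhd G v) v = 2 * m by rewrite -S2.
have opt : 104 / 100 * (OPT b' G)%:R <= 2 * m.
  by rewrite -SE xE; apply: (OPT_le_value n_gt0 nT bge ok); rewrite ler_nat.
have alt : (forall u v, x u v = 1) \/ 57 / 100 * b%:R <= 2 * m.
  by rewrite -SE xE; apply: value_alternative.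
case: alt => [x1|m_ge].
  (* All biases are 1: an outcome missing any coin has probability 0, and the full outcome has
     exactly [m] hits. *)
  rewrite big1 ?expR_ge0 // => o _; case: (boolP (small o)) => so; last by rewrite mulr0.
  rewrite mulr1; apply: contrapT => jn0; move: so; apply/negP; rewrite -leqNgt.
  have full v u : u \in o v.
    apply: contrapT => /negP uv; apply: jn0; rewrite /joint (bigD1 v) //= /subset_pmf.
    by rewrite (bigD1 u) //= (negbTE uv) /bern x1 subrr !mul0r.
  have opt0 := ler0n R (OPT b' G).
  rewrite -(ler_nat R) natrM; suff -> : (hits (oriented G) o)%:R = m by lra.
  rewrite /hits -sum1dep_card natr_sum /m big_mkcondr /=.
  by apply: eq_bigr => q _; rewrite full x1.
(* Since [k] is at most [m / 1.04], the factor [50/49] still leaves a gap of over 1% of [m], and [m]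
   is at least [0.285 * b]. *)
have s0 : 0 < 1 / 50 :> R by lra.
have s1 : 1 / 50 < 1 :> R by lra.
apply: le_trans (_ : _ <= \sum_o joint x o * (hits (oriented G) o <= k)%N%:R) _.
  apply: ler_sum => o _; apply: ler_wpM2l; first exact: joint_ge0.
  rewrite ler_nat /small; case: ltnP => // h; rewrite lt0b /k.
  by lia.
apply: le_trans (hits_lower_tail (oriented G) k x01 s0 s1) _.
rewrite ler_expR -/m; have : k%:R <= (OPT b' G)%:R / 2 :> R.
  by rewrite ler_pdivlMr // -natrM ler_nat /k; lia.
have -> : k%:R / (1 - 1 / 50) = 50 / 49 * k%:R :> R by field.
by lra.
Qed.

Lemma algorithm_accuracy (P : protocol R n) : implements P (2 * T).+1 law ->
  ((1 - ((2 * T)%:R * (n%:R * bit_error) + n.+1%:R * rounding_error))%:E <=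
    transcript_prob P G
      [set tau | implicit_bmatching b G (decoded output G tau) /\
        ((OPT b' G)%:R / 2 <= (implicit_size G (decoded output G tau))%:R :> R)%R]%classic)%E.
Proof.
move=> Pth; pose beta (i : nat) : R :=
  if (i < 2 * T)%N then n%:R * bit_error else n.+1%:R * rounding_error.
have beta0 i : 0 <= beta i by rewrite /beta; case: ifP => _; rewrite mulr_ge0 ?expR_ge0.
have -> : (2 * T)%:R * (n%:R * bit_error) + n.+1%:R * rounding_error
    = \sum_(0 <= i < (2 * T).+1) beta i.
  rewrite big_nat_recr //= big_mkord {2}/beta ltnn; congr (_ + _).
  rewrite (eq_bigr (fun=> n%:R * bit_error)) => [|i _]; last by rewrite /beta ltn_ord.
  by rewrite sumr_const card_ord mulr_natl.
apply: (transcript_prob_lower (I := invariant)) Pth _ beta0 _ _ _.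
- exact: law_range.
- move=> p; rewrite ltnS leq_eqVlt => /orP[/eqP pT|pT] Ip.
    by rewrite /beta pT ltnn; apply: rounding_step.
  by rewrite /beta pT; apply: bit_step.
- move=> p pT [_ /(_ pT) /andP[/forallP deg opt]].
  have outE : decoded output G (map (@encode n) p) = forward (nth [ffun=> finset.set0] p (2 * T)).
    by apply/funext => v; rewrite /decoded /output heard_encode // pT.
  rewrite /= outE; split.
    by apply/forallP => v; rewrite (degree_rounded R) deg.
  by rewrite /implicit_size (card_rounded R) ler_pdivrMr // -natrM ler_nat mulnC.
- by split.
Qed.

End Run.
End Algorithm.

(** * Numerical estimates and choice of parameters *)

Section Bounds.
Variable R : realType.

Lemma ln_nat_ge_half (n : nat) : (1 < n)%N -> 1 / 2 <= ln n%:R :> R.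
Proof.
move=> n1; rewrite -ler_expR lnK ?posrE ?ltr0n ?(ltn_trans _ n1) //.
apply: (@le_trans _ _ 2); last by rewrite ler_nat.
have := expR_ge1Dx (- (1 / 2) : R); have := expR_gt0 (1 / 2 : R); rewrite expRN.
set e := expR _ => e0 h.
rewrite -[e]invrK -[leRHS]invrK lef_pV2 ?posrE ?invr_gt0 //; lra.
Qed.

(** The length exceeds [101 * ln n], and [101/100] is at least [expR (1 / 101)] because
    [expR (- (1 / 101))] is at least [100/101]. The bound [ln n >= 1/2] absorbs the rounding up. *)
Lemma phase_length_exists (n : nat) : (1 < n)%N ->
  exists T : nat, [/\ (0 < T)%N, T%:R <= 103 * ln n%:R :> R & n%:R <= (101 / 100) ^+ T :> R].
Proof.
move=> n1; have L := ln_nat_ge_half n1; set l : R := ln n%:R in L *.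
have n0 : 0 < n%:R :> R by rewrite ltr0n ltnW.
have l101 : 0 <= 101 * l by lra.
have /andP[t1 t2] := truncn_itv l101.
exists (Num.truncn (101 * l)).+1; split=> //.
  by rewrite -natr1; lra.
apply: (@le_trans _ _ (expR (1 / 101) ^+ (Num.truncn (101 * l)).+1)).
  rewrite -expRM_natl -[leLHS](lnK (x := n%:R)) ?posrE // ler_expR -/l.
  by lra.
have q0 : 0 <= 101 / 100 :> R by lra.
apply: lerXn2r; rewrite ?nnegrE ?expR_ge0 //.
have := expR_ge1Dx (- (1 / 101) : R); have := expR_gt0 (1 / 101 : R); rewrite expRN.
set e := expR _ => e0 h.
by rewrite -[e]invrK -[leRHS]invrK lef_pV2 ?posrE ?invr_gt0 //; lra.
Qed.

(** The margin 10 in the exponent gives a factor [n ^+ 10], which dominates [206 * n * n + n + 1]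
    already at [n = 2]. *)
Lemma failure_bound (n T : nat) (c be re : R) : (1 < n)%N -> 1 <= c ->
  T%:R <= 103 * ln n%:R :> R ->
  be <= expR (- ((c + 10) * ln n%:R)) -> re <= expR (- ((c + 10) * ln n%:R)) ->
  (2 * T)%:R * (n%:R * be) + n.+1%:R * re <= n%:R `^ (- c).
Proof.
move=> n1 c1 Tl be_le re_le; set E := expR _ in be_le re_le.
have n0 : 0 < n%:R :> R by rewrite ltr0n ltnW.
have n2 : 2 <= n%:R :> R by rewrite ler_nat.
have ln_le : ln n%:R <= n%:R :> R.
  have x1 : -1 < n%:R - 1 :> R by lra.
  have := le_ln1Dx x1; have -> : 1 + (n%:R - 1) = n%:R :> R by ring.
  lra.
have EE : E * n%:R ^+ 10 = n%:R `^ (- c).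
  have -> : n%:R ^+ 10 = expR (10 * ln n%:R) :> R by rewrite expRM_natl lnK.
  rewrite -expRD /powR gt_eqF //; congr expR; lra.
rewrite -EE; have E0 : 0 < E by apply: expR_gt0.
apply: (@le_trans _ _ (E * (206 * n%:R * n%:R + (n%:R + 1)))).
  have h1 : (2 * T)%:R * (n%:R * be) <= (206 * n%:R) * (n%:R * E).
    apply: (@le_trans _ _ ((2 * T)%:R * (n%:R * E))).
      by rewrite ler_wpM2l // ler_wpM2l // ltW.
    rewrite ler_wpM2r ?mulr_ge0 ?(ltW n0) ?(ltW E0) // natrM; lra.
  have h2 : n.+1%:R * re <= (n%:R + 1) * E by rewrite natr1 ler_wpM2l.
  by lra.
rewrite ler_wpM2l ?(ltW E0) //.
set x : R := n%:R in n2 *.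
have x2 : 4 <= x ^+ 2 by nra.
have x4 : 16 <= (x ^+ 2) ^+ 2 by nra.
have x8 : 256 <= ((x ^+ 2) ^+ 2) ^+ 2 by nra.
have -> : x ^+ 10 = ((x ^+ 2) ^+ 2) ^+ 2 * x ^+ 2 by rewrite -!exprM -exprD.
apply: (@le_trans _ _ (256 * x ^+ 2)); first by nra.
by rewrite ler_wpM2r ?sqr_ge0.
Qed.

(** At [n = 1] the round bound [K * ln n] is 0, so the protocol must halt at once; there are no
    edges. *)
Lemma trivial_protocol (eps c : R) (b b' n : nat) : (n <= 1)%N ->
  exists (P : protocol R n) (D : decoder n),
    is_LEDP eps P /\ terminates_within 0 P /\
    forall G : graph n,
      ((1 - n%:R `^ (- c))%:E <=
        transcript_prob P G
          [set tau | implicit_bmatching b G (decoded D G tau) /\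
            ((OPT b' G)%:R / 2 <= (implicit_size G (decoded D G tau))%:R :> R)%R]%classic)%E.
Proof.
move=> n1; exists (fun _ => None), (fun _ _ _ => finset.set0).
have noedge (G : graph n) : edges G = finset.set0.
  apply/setP => e; rewrite inE; apply/negP => /edges_card2 e2.
  by have := max_card (mem e); rewrite e2 card_ord; lia.
split.
  move=> G G' E; rewrite /edge_neighbors /differ_by_one !noedge.
  by rewrite finset.setDv finset.setU0 cards0.
split.
  move=> tau run; rewrite lern0 size_eq0; case: tau run => // o tau run.
  by have := run 0%N isT.
move=> G; apply: (@le_trans _ _ 1%:E).
  by rewrite lee_fin gerBl powR_ge0.
have good : implicit_bmatching b G (decoded (fun _ _ _ => finset.set0) G [::]) /\
    ((OPT b' G)%:R / 2 <= (implicit_size G (decoded (fun _ _ _ => finset.set0) G [::]))%:R :> R)%R.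
  rewrite /implicit_bmatching /implicit_size noedge finset.set0I cards0; split.
    apply/forallP => v; rewrite /degree_in (_ : [set _ in _ | _]%SET = finset.set0) ?cards0 //.
    by apply/setP => e; rewrite !inE.
  rewrite /OPT big1 ?mul0r // => F /andP[]; rewrite noedge finset.subset0 => /eqP -> _.
  by rewrite cards0.
have := @esum_ge_seq R (transcript n) [set tau | implicit_bmatching b G (decoded (fun _ _ _ => finset.set0) G tau) /\
    ((OPT b' G)%:R / 2 <= (implicit_size G (decoded (fun _ _ _ => finset.set0) G tau))%:R :> R)%R]%classic
  (run_prob (fun _ => None) G [::]) [:: [::]] isT (run_prob_ge0 _ _ _).
by rewrite big_seq1 indicE mem_set //= mul1r.
Qed.

End Bounds.

Theorem mainTheorem8 (R : realType) (c : R) (hc : 1 <= c) :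
  exists C K : R, 0 < C /\ 0 < K /\
  forall (eps eta : R) (b' b n : nat),
    0 < eps < 1 -> 0 < eta < 1 / 2 -> (1 <= b')%N -> (0 < n)%N ->
    (1 + eta) ^+ 2 / (1 - eta) * b'%:R
      + C * (ln n%:R ^+ 2 / (eta ^+ 4 * eps)) <= b%:R ->
    exists (P : protocol R n) (D : decoder n),
      is_LEDP eps P /\
      terminates_within (K * ln n%:R) P /\
      forall G : graph n,
        ((1 - n%:R `^ (- c))%:E <=
          transcript_prob P G
            [set tau | implicit_bmatching b G (decoded D G tau) /\
                       ((OPT b' G)%:R / 2 <=
                          (implicit_size G (decoded D G tau))%:R :> R)%R]%classic)%E.
Proof.
(* The bits need [C] at least [400 * 103 * (c + 10)]; the rounding needs [b] at least
   [200 * 200 * (c + 10) * ln n], and [ln n >= 1/2]. *)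
have [C CE] : exists C, C = 100 * 1000 * (c + 10) by eexists.
have C0 : 0 < C by rewrite CE; lra.
(* The [2 * T + 1] rounds number at most [206 * ln n + 1], and [ln n >= 1/2]. *)
exists C, 208; split=> //.
split; first by lra.
move=> eps eta b' b n /andP[eps0 eps1] /andP[eta0 eta1] b'1 n0 hb.
have [n1|n1] := leqP n 1.
  have -> : ln n%:R = 0 :> R by have -> : n = 1%N by [lia]; rewrite ln1.
  by rewrite mulr0; apply: trivial_protocol.
have [T [T0 Tl nT]] := phase_length_exists R n1.
have L := ln_nat_ge_half R n1; set l : R := ln n%:R in hb Tl L *.
(* From here [eta] is eliminated: the hypothesis on [b] yields [b' <= b] and
   [C * (l ^+ 2 / eps) <= b]. *)
have ratio1 : 1 <= (1 + eta) ^+ 2 / (1 - eta).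
  by rewrite ler_pdivlMr; [nra | lra].
have eta4 : eta ^+ 4 <= 1 by apply: exprn_ile1; lra.
have eta40 : 0 < eta ^+ 4 by apply: exprn_gt0.
have add : l ^+ 2 / eps <= l ^+ 2 / (eta ^+ 4 * eps).
  rewrite ler_wpM2l ?sqr_ge0 // lef_pV2 ?posrE ?mulr_gt0 //.
  by rewrite -[leRHS]mul1r ler_wpM2r // ltW.
have l20 : 0 <= l ^+ 2 / eps by rewrite divr_ge0 ?sqr_ge0 // ltW.
have b'b : (b' <= b)%N.
  rewrite -(ler_nat R); apply: le_trans hb.
  have : 0 <= C * (l ^+ 2 / (eta ^+ 4 * eps)).
    by rewrite mulr_ge0 ?(ltW C0) // (le_trans l20 add).
  have : b'%:R <= (1 + eta) ^+ 2 / (1 - eta) * b'%:R by rewrite ler_peMl.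
  by lra.
have bC : C * (l ^+ 2 / eps) <= b%:R.
  apply: le_trans hb; rewrite -[leLHS]add0r; apply: lerD; last by rewrite ler_wpM2l // ltW.
  by rewrite mulr_ge0 // (le_trans _ ratio1).
have epsb : C * l ^+ 2 <= eps * b%:R.
  by rewrite [leRHS]mulrC -ler_pdivrMr // -mulrA.
have leps : l ^+ 2 <= l ^+ 2 / eps.
  by rewrite ler_pdivlMr // ler_piMr ?sqr_ge0 // ltW.
pose a := (c + 10) * l.
have a0 : 11 / 2 <= a by rewrite /a; nra.
have al : a / 2 <= a * l by rewrite ler_pM2l; lra.
have Cl : C * l ^+ 2 = 100 * 1000 * (a * l) by rewrite CE /a expr2; ring.
have bl : 100 * 500 * a <= b%:R.
  apply: le_trans bC; apply: (@le_trans _ _ (C * l ^+ 2)); last by rewrite ler_pM2l.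
  by rewrite Cl; lra.
have b100 : 100 <= b%:R :> R by apply: le_trans bl; lra.
(* The budget is split over [2 * T] bit rounds and the two ends of an edge. *)
pose eps' := eps / (4 * T%:R).
have T0' : 0 < T%:R :> R by rewrite ltr0n.
have eps'0 : 0 <= eps' by rewrite divr_ge0 ?mulr_ge0 ?ltW.
have [P Pth] : exists P : protocol R n, implements P (2 * T).+1 (law T b eps').
  apply: (protocol_exists _ _ eps'0) => [past v N u|past v]; first exact: law_range.
  exact: law_dp.
exists P, (output (n := n) T); split.
  by apply: (algorithm_dp eps'0 Pth); rewrite /eps' mulrC divfK // mulf_neq0 ?gt_eqF.
split.
  by apply: (implements_terminates Pth); rewrite -natr1 natrM; lra.
move=> G; apply: le_trans (algorithm_accuracy eps'0 G n0 nT b100 b'b Pth).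
rewrite lee_fin lerD2l lerN2; apply: failure_bound => //.
  rewrite /bit_error ler_expR lerN2 -/l.
  have -> : eps' * b%:R / 100 = eps * b%:R / (400 * T%:R).
    by rewrite /eps'; field; rewrite gt_eqF.
  rewrite ler_pdivlMr; last by lra.
  apply: le_trans epsb; rewrite Cl -/a.
  apply: (@le_trans _ _ (a * (400 * (103 * l)))); last by lra.
  by rewrite ler_wpM2l //; lra.
by rewrite /rounding_error ler_expR lerN2 -/l -/a; lra.
Qed.
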